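(* Let $\alpha>1$. The reproducing kernel $\mathcal K_\alpha$ of $\mathcal B^2_\alpha$ may be written, for all $v,x\in\mathfrak X$, as $$\mathcal K_\alpha(v,x)=\sum_{m=-h(x\wedge v)-1}^{+\infty}b_{-m-1}^{-1}\Bigl(\sum_{j=0}^{m+h(v)}q^{-j}\Bigr)\Bigl(\sum_{i=0}^{m+h(x)}q^{-i}\Bigr)\Gamma_{m+h(v),\,v}\bigl(p^{m+h(x)}(x)\bigr),$$ where the term with $m=-h(x\wedge v)-1$ is understood to be $0$ if $x\wedge v\in\{x,v\}$. In particular, $\mathcal K_\alpha$ is real and symmetric.
   Context: Tree. Let $q\ge 2$ be an integer and let $\mathfrak X$ be (the vertex set of) the $q$-homogeneous tree: the connected graph without cycles in which every vertex has exactly $q+1$ neighbours ($x\sim y$ means $x,y$ are neighbours); $d$ is the edge-counting distance, $\mathbb N=\{0,1,2,\dots\}$. An infinite chain is a sequence $(x_i)_{i\in\mathbb N}$ with $x_i\sim x_{i+1}$ and $x_i\ne x_{i+2}$; two infinite chains $(x_i),(y_j)$ are equivalent if for some $m\in\mathbb Z$ one has $x_i=y_{i+m}$ eventually; a boundary point is an equivalence class. Fix a boundary point $\omega$. For $x\in\mathfrak X$, $[x,\omega)$ is the infinite chain starting at $x$ in the class $\omega$ and $x\wedge y$ is the vertex $z$ with $[x,\omega)\cap[y,\omega)=[z,\omega)$. Vertices $x,y$ lie on the same horocycle if $d(x,x\wedge y)=d(y,x\wedge y)$. Fix a horocycle $H_0$ and, for $k\in\mathbb Z$, let $H_k=\{x: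 d(x,x\wedge y)=d(y,x\wedge y)+k \text{ for some } y\in H_0\}$; the $H_k$ partition $\mathfrak X$. The horocyclic index $h(x)$ is the integer with $x\in H_{h(x)}$. The predecessor $p(x)$ is the only neighbour of $x$ in $H_{h(x)-1}$; the set $S(x)$ of successors consists of the other $q$ neighbours, which lie in $H_{h(x)+1}$; $p^n$ is the $n$-th iterate of $p$ ($p^0=\mathrm{id}$). $U_x=\{y:[x,\omega)\subseteq[y,\omega)\}$ is the sector generated by $x$ and $\dot U_x=U_x\setminus\{x\}$. A sum whose starting index exceeds its ending index is $0$. Spaces. $f:\mathfrak X\to\mathbb C$ is harmonic if $f(x)=\frac1{q+1}\sum_{y\sim x}f(y)$ for all $x\in\mathfrak X$. For $\alpha>1$, $\sigma_\alpha(x)=q^{-\alpha h(x)}$, and $\mathcal B^2_\alpha$ is the Hilbert space of harmonic $f:\mathfrak X\to\mathbb C$ with $\sum_{x}|f(x)|^2\sigma_\alpha(x)<\infty$, with inner product $\langle f,g\rangle=\sum_x f(x)\overline{g(x)}\sigma_\alpha(x)$. Point evaluations are continuous on $\mathcal B^2_\alpha$; for $v\in\mathfrak X$, $\mathcal K_{\alpha,v}$ is the unique element of $\mathcal B^2_\alpha$ with $f(v)=\langle f,\mathcal K_{\alpha,v}\rangle$ for all $f\in\mathcal B^2_\alpha$, and the reproducing kernel is $\mathcal K_\alpha(v,x)=\mathcal K_{\alpha,v}(x)$. The functions $\Gamma$. For $v\in\mathfrak X$ define $\Gamma_v:\mathfrak X\times\mathfrak X\to\mathbb R$ by: $\Gamma_v(x,y)=0$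 if $x\notin\dot U_v$ or $y\notin\dot U_v$; $\Gamma_v(x,y)=\frac{q-1}{q}$ if $x,y\in U_z$ for some common $z\in S(v)$; $\Gamma_v(x,y)=-\frac1q$ otherwise. For $n\in\mathbb N$ put $\Gamma_{n,v}=\Gamma_{p^{n+1}(v)}(p^n(v),\cdot)$. The constants. For $n\in\mathbb Z$, $b_n=b_{n,\alpha}=q^{-\alpha n}\sum_{l=0}^{+\infty}q^{-\alpha(l+1)}\bigl(\sum_{i=0}^{l}q^{-i}\bigr)\bigl(\sum_{j=0}^{l}q^{j}\bigr)$. *)

(* Defs.v *)
From mathcomp Require Import all_boot all_order all_algebra.
From mathcomp Require Import all_classical all_reals all_analysis.
From mathcomp Require Import complex.

Set Implicit Arguments.
Unset Strict Implicit.
Unset Printing Implicit Defensive.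

Import Order.TTheory GRing.Theory Num.Theory.
Import numFieldNormedType.Exports.

Local Open Scope classical_set_scope.
Local Open Scope ring_scope.

Section Tree.
Variables (X : choiceType) (adj : rel X).

(* ucycle adj c: consecutive entries of the duplicate-free sequence c are
   adjacent, and so are the last and the first; for size c <= 2 this is a
   degenerate cycle (a single edge run back and forth). *)
Definition homogeneous_tree (q : nat) : Prop :=
  [/\ symmetric adj,
      irreflexive adj,
      forall x y, exists2 p, path adj x p & last x p = y,
      forall c, ucycle adj c -> (size c <= 2)%N
    & forall x, ([set y | adj x y] #= `I_q.+1)%card].

Definition walk_length (x y : X) (n : nat) : Prop :=
  exists p, [/\ path adj x p, last x p = y & size p = n].

(* xget d A is an element of A if there is one, and d otherwise; the sets it is
   applied to below are singletons as soon as adj is a homogeneous tree, omega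
   a boundary point and H0 a horocycle. *)
Definition dist (x y : X) : nat :=
  xget 0%N [set n | walk_length x y n /\
                    forall n', walk_length x y n' -> (n <= n')%N].

Definition chain : set (nat -> X) :=
  [set c | forall i, adj (c i) (c i.+1) /\ c i <> c i.+2].

Definition chain_equiv (c c' : nat -> X) : Prop :=
  exists m : int, \forall i \near \oo,
    forall j : nat, j%:Z = i%:Z + m -> c i = c' j.

Definition boundary_point (omega : set (nat -> X)) : Prop :=
  exists2 c, chain c & omega = [set c' | chain c' /\ chain_equiv c c'].

Section Horocycles.
Variable omega : set (nat -> X).

Definition ray_chain (x : X) : nat -> X :=
  xget (fun=> x) [set c | omega c /\ c 0%N = x].

Definition ray (x : X) : set X := range (ray_chain x).

Definition meet (x y : X) : X := xget x [set z | ray x `&` ray y = ray z].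

Definition same_horocycle (x y : X) : Prop :=
  dist x (meet x y) = dist y (meet x y).

Definition is_horocycle (H : set X) : Prop :=
  exists o, H = [set x | same_horocycle o x].

Definition sector (x : X) : set X := [set y | ray x `<=` ray y].

Definition dsector (x : X) : set X := sector x `\ x.

Variable H0 : set X.

Definition Hk (k : int) : set X :=
  [set x | exists2 y, H0 y &
           (dist x (meet x y))%:Z = (dist y (meet x y))%:Z + k].

Definition hindex (x : X) : int := xget 0 [set k | Hk k x].

Definition predecessor (x : X) : X :=
  xget x [set y | adj x y /\ Hk (hindex x - 1) y].

Definition successors (x : X) : set X :=
  [set y | adj x y /\ y <> predecessor x].

End Horocycles.
End Tree.

(* The sum of an absolutely summable real family: \esum is meaningful only for
   nonnegative families, hence the splitting into positive and negative parts. *)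
Definition rsum (R : realType) (X : choiceType) (f : X -> R) : R :=
  fine (\esum_(x in [set: X]) ((EFin \o f)^\+ x)%E) -
  fine (\esum_(x in [set: X]) ((EFin \o f)^\- x)%E).

Definition csum (R : realType) (X : choiceType) (f : X -> R[i]) : R[i] :=
  Complex (rsum (fun x => complex.Re (f x))) (rsum (fun x => complex.Im (f x))).

Section Bergman.
Variables (R : realType) (X : choiceType) (adj : rel X) (q : nat).
Variables (omega : set (nat -> X)) (H0 : set X).

Local Notation h := (hindex adj omega H0).
Local Notation p := (predecessor adj omega H0).
Local Notation S := (successors adj omega H0).

Definition harmonic (f : X -> R[i]) : Prop :=
  forall x, f x = (q.+1)%:R^-1 * \sum_(y \in [set y | adj x y]) f y.

Definition sigma (alpha : R) (x : X) : R := q%:R `^ (- alpha * (h x)%:~R).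

Definition bergman (alpha : R) : set (X -> R[i]) :=
  [set f | harmonic f /\
     (\esum_(x in [set: X])
        (Normc.normc (f x) ^+ 2 * sigma alpha x)%:E < +oo)%E].

Definition inner (alpha : R) (f g : X -> R[i]) : R[i] :=
  csum (fun x => f x * ((g x)^*)%C * ((sigma alpha x)%:C)%C).

(* repro_kernel alpha v is the function K_(alpha, v), so that
   repro_kernel alpha v x is K_alpha(v, x). *)
Definition repro_kernel (alpha : R) (v : X) : X -> R[i] :=
  xget (fun=> 0) [set k | bergman alpha k /\
                          forall f, bergman alpha f -> f v = inner alpha f k].

Definition Gamma (v x y : X) : R :=
  if (x \notin dsector omega v) || (y \notin dsector omega v) then 0
  else if `[< exists z, [/\ S v z, sector omega z x & sector omega z y] >]
  then (q%:R - 1) / q%:R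
  else - q%:R^-1.

Definition Gamma_n (n : nat) (v y : X) : R :=
  Gamma (iter n.+1 p v) (iter n p v) y.

Definition bconst (alpha : R) (n : int) : R :=
  q%:R `^ (- alpha * n%:~R) *
  limn (series (fun l : nat =>
    q%:R `^ (- alpha * (l.+1)%:R) *
    (\sum_(0 <= i < l.+1) q%:R ^- i) * (\sum_(0 <= j < l.+1) q%:R ^+ j))).

(* \sum_(j = 0)^N q^-j for an integer N; it is 0 if N < 0. *)
Definition qsum (N : int) : R :=
  if N is Posz n then \sum_(0 <= j < n.+1) q%:R ^- j else 0.

(* For m >= - h w - 1 the integers m + h v and m + h x are >= -1, and one of
   them is -1 only in the case set to 0: elsewhere absz is a cast to nat. *)
Definition kernel_term (alpha : R) (v x : X) (m : int) : R :=
  let w := meet omega x v in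
  if (m == - h w - 1) && (w \in [:: x; v]) then 0
  else (bconst alpha (- m - 1))^-1 * qsum (m + h v) * qsum (m + h x) *
       Gamma_n (absz (m + h v)) v (iter (absz (m + h x)) p x).

Definition kernel_series (alpha : R) (v x : X) : R ^nat :=
  series (fun k : nat =>
    kernel_term alpha v x (- h (meet omega x v) - 1 + k%:Z)).

End Bergman.

(* Main.v *)
Require Import Defs.
From mathcomp Require Import all_boot all_order all_algebra.
From mathcomp Require Import all_classical all_reals all_analysis.
From mathcomp Require Import complex finmap.
From mathcomp Require Import ring lra zify.
Import Order.TTheory GRing.Theory Num.Theory.
Import numFieldNormedType.Exports.
Local Open Scope classical_set_scope.
Local Open Scope ring_scope.

Set Implicit Arguments.
Unset Strict Implicit.
Unset Printing Implicit Defensive.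

(** For a harmonic function [F], the increments [F x - F (p x)] along the edges
    directed towards the boundary point form a flow: the increment at a vertex
    is the sum of the increments at its [q] children.  A square summable [F]
    tends to [0] along every ray, so [F] is recovered by summing its flow along
    the ray, and the Bergman space is the orthogonal sum over the vertices [u]
    of the spaces of functions whose flow starts at the children of [u] with
    total [0] and then splits evenly.  On the summand of [u] evaluation at [v] is
    explicit; the product of geometric sums, the constant $b$ and the factor
    $\Gamma$ (a Kronecker symbol minus its average over the [q] children) of the
    term of index $m = - h(u) - 1$ are those of its kernel.

    The proof does not set up this decomposition; it checks the reproducing
    property of the sum directly.  Pairing [F] with the potential of a sector is
    computed level by level, since a level sum of [F] depends only on [F] above
    the sector and on the flow into it ([sum_levels], [pairing_green]).  The
    pairing with the [n]-th summand then involves the flow only ([pairing_layer]),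
    and the partial sums telescope to [F v] up to terms on the ray of [v] that
    vanish in the limit ([pairing_kern_part], [cvg_ancestors]).  The limit is
    exchanged with the sum over the tree by dominated convergence; the majorant
    is constant on the sets of vertices branching off the ray of [v] at a given
    point, and decays fast enough to be square summable when $\alpha > 1$
    ([kern_reproduces]).  Two reproducing elements evaluated against each other
    show that the reproducing element is unique and that a real kernel is
    symmetric ([reproducing_conj]).

    On the geometric side, acyclicity is used once, to show that a walk without
    backtracking never returns ([nonbacktracking_neq]); hence exactly one chain
    of the class issues from each vertex, every edge is directed, and the tree is
    described by its parent map and a Busemann function.  In those terms the
    terms of the series are the summands above, up to the shift of the
    summation index ([kernel_seriesE]). *)

(** * Unconditional sums *)

Section Sums.
Variables (R : realType) (X : choiceType).
Implicit Types (f g H : X -> R) (s t : seq X).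

Lemma sum_cat_filter f s t : uniq s -> uniq t -> {subset s <= t} ->
  \sum_(x <- t) f x =
  \sum_(x <- s) f x + \sum_(x <- [seq x <- t | x \notin s]) f x.
Proof.
move=> us ut st; rewrite (bigID (mem s)) /= big_filter; congr (_ + _).
rewrite -big_filter; apply: perm_big; apply: uniq_perm => //.
  exact: filter_uniq.
by move=> x; rewrite mem_filter; apply/andP/idP => [[]//|xs]; rewrite xs st.
Qed.

Lemma ler_sum_subset g s t : uniq s -> uniq t -> {subset s <= t} ->
  (forall x, 0 <= g x) -> \sum_(x <- s) g x <= \sum_(x <- t) g x.
Proof.
move=> us ut st g0; rewrite (sum_cat_filter g us ut st) lerDl.
by apply: sumr_ge0.
Qed.

Lemma ler_sum_supp g s t : uniq s -> uniq t ->
  (forall x, x \notin t -> g x = 0) -> (forall x, 0 <= g x) ->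
  \sum_(x <- s) g x <= \sum_(x <- t) g x.
Proof.
move=> us ut g0t g0; rewrite (bigID (mem t)) /= [X in _ + X]big1 ?addr0 //.
rewrite -big_filter; apply: ler_sum_subset => //; first exact: filter_uniq.
by move=> x; rewrite mem_filter => /andP[].
Qed.

(** Summability is handled through real bounds on the finite partial sums:
    every estimate below is obtained on finite sequences of vertices. *)
Definition fsum_le g (B : R) := forall s, uniq s -> \sum_(x <- s) g x <= B.

Definition fsummable g := exists B, fsum_le g B.

Lemma fsum_leP g B : (forall x, 0 <= g x) ->
  fsum_le g B <-> (\esum_(x in [set: X]) (g x)%:E <= B%:E)%E.
Proof.
move=> g0; split=> [gB|gB s us].
  apply: ge_ereal_sup => _ [A [fA _]] <-.
  by rewrite fsbig_finite //= sumEFin lee_fin; apply: gB; exact: fset_uniq.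
rewrite -lee_fin -sumEFin; apply: le_trans gB; rewrite fsbig_seq //.
by apply: esum_ge; exists [set` s] => //; split=> //; exact: finite_seq.
Qed.

Lemma fsum_le_mono g g' B :
  (forall x, g x <= g' x) -> fsum_le g' B -> fsum_le g B.
Proof. by move=> gg' g'B s us; apply: le_trans (g'B s us); exact: ler_sum. Qed.

Lemma fsummable_mono g g' :
  (forall x, g x <= g' x) -> fsummable g' -> fsummable g.
Proof. by move=> gg' [B gB]; exists B; exact: fsum_le_mono gB. Qed.

Lemma fsummableD g g' :
  fsummable g -> fsummable g' -> fsummable (fun x => g x + g' x).
Proof.
move=> [B gB] [B' gB']; exists (B + B') => s us.
by rewrite big_split /= lerD // ?gB ?gB'.
Qed.

Lemma fsummableZ c g : 0 <= c -> fsummable g -> fsummable (fun x => c * g x).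
Proof.
move=> c0 [B gB]; exists (c * B) => s us.
by rewrite -mulr_sumr ler_wpM2l // gB.
Qed.

Lemma fsum_le_fine g : (forall x, 0 <= g x) -> fsummable g ->
  fsum_le g (fine (\esum_(x in [set: X]) (g x)%:E)) /\
  forall B, fsum_le g B -> fine (\esum_(x in [set: X]) (g x)%:E) <= B.
Proof.
move=> g0 [B /(fsum_leP _ g0) gB].
have e0 : (0 <= \esum_(x in [set: X]) (g x)%:E)%E.
  by apply: esum_ge0 => x _; rewrite lee_fin.
have efin : \esum_(x in [set: X]) (g x)%:E \is a fin_num.
  by rewrite ge0_fin_numE // (le_lt_trans gB) // ltry.
split=> [|C /(fsum_leP _ g0)]; first by apply/fsum_leP => //; rewrite fineK.
by move=> gC; rewrite -lee_fin fineK.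
Qed.

(** A finite set whose sum is within [e] of the supremum of the finite sums
    leaves at most [e] to any finite set disjoint from it. *)
Lemma fsum_tail H e : (forall x, 0 <= H x) -> fsummable H -> 0 < e ->
  exists2 s0, uniq s0 & forall s, uniq s ->
    (forall x, x \in s -> x \notin s0) -> \sum_(x <- s) H x <= e.
Proof.
move=> H0 sH e0; have [up lo] := fsum_le_fine H0 sH.
set E := fine _ in up lo.
have : ~ fsum_le H (E - e) by move=> /lo; lra.
move=> /existsNP[s0 /not_implyP[us0 /negP]]; rewrite -ltNge => hs0.
exists s0 => // s us ds.
have := up (s0 ++ s); rewrite big_cat /= cat_uniq us0 us andbT /=.
have -> : ~~ has (mem s0) s by apply/hasPn => x /ds.
by move=> /(_ isT); lra.
Qed.

(** One finite set serves all the functions below a summable majorant: its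
    complement carries at most [e] of the mass of the majorant.  Linearity,
    summation along an exhaustion and dominated convergence all follow by
    replacing each [rsum] with a finite sum over the same set. *)
Lemma rsum_approx H e : (forall x, 0 <= H x) -> fsummable H -> 0 < e ->
  exists2 s0, uniq s0 & forall f s, (forall x, `|f x| <= H x) ->
    uniq s -> {subset s0 <= s} -> `|rsum f - \sum_(x <- s) f x| <= e.
Proof.
move=> H0 sH e0; have [s0 us0 tail] := fsum_tail H0 sH e0.
exists s0 => // f s fH us ss.
(* Below [H], a finite sum over a superset of [s0] misses at most the tail of
   [H]; applied to both the positive and the negative part of [f], the two
   errors lie between 0 and [e], so their difference is at most [e]. *)
have key g : (forall x, 0 <= g x <= H x) ->
    \sum_(x <- s) g x <= fine (\esum_(x in [set: X]) (g x)%:E)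
                      <= \sum_(x <- s) g x + e.
  move=> gH; have g0 x : 0 <= g x by case/andP: (gH x).
  have gleH x : g x <= H x by case/andP: (gH x).
  have [up lo] := fsum_le_fine g0 (fsummable_mono gleH sH).
  rewrite up //=; apply: lo => t ut.
  rewrite (bigID (mem s)) /= -big_filter -[X in _ + X]big_filter lerD //.
    by apply: ler_sum_subset => //; rewrite ?filter_uniq // => x;
      rewrite mem_filter => /andP[].
  apply: le_trans (_ : \sum_(x <- [seq x <- t | x \notin s]) H x <= e).
    exact: ler_sum.
  apply: tail; first exact: filter_uniq.
  by move=> x; rewrite mem_filter => /andP[xs _]; apply: contra xs; exact: ss.
have fE x : f x = Num.max (f x) 0 - Num.max (- f x) 0.
  by case: (lerP (f x) 0); case: (lerP (- f x) 0); lra.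
have pos x : 0 <= Num.max (f x) 0 <= H x.
  by rewrite le_max lexx orbT /= ge_max H0 andbT (le_trans _ (fH x)) // ler_norm.
have neg x : 0 <= Num.max (- f x) 0 <= H x.
  rewrite le_max lexx orbT /= ge_max H0 andbT (le_trans _ (fH x)) //.
  by rewrite -normrN ler_norm.
rewrite /rsum.
have -> : \esum_(x in [set: X]) ((EFin \o f)^\+ x)%E =
    \esum_(x in [set: X]) (Num.max (f x) 0)%:E.
  by apply: eq_esum => x _; rewrite funeposE /= EFin_max.
have -> : \esum_(x in [set: X]) ((EFin \o f)^\- x)%E =
    \esum_(x in [set: X]) (Num.max (- f x) 0)%:E.
  by apply: eq_esum => x _; rewrite funenegE /= EFin_max.
have := key _ pos; have := key _ neg.
rewrite [X in _ -> _ -> `|_ - X| <= _](_ : _ = \sum_(x <- s) Num.max (f x) 0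
   - \sum_(x <- s) Num.max (- f x) 0); last first.
  by rewrite -sumrB; apply: eq_bigr => x _; exact: fE.
move: (fine _) (fine _) (\sum_(x <- s) _) (\sum_(x <- s) _) => a b c d.
move=> /andP[h1 h2] /andP[h3 h4]; rewrite ler_norml; apply/andP; split; lra.
Qed.

Definition abs_summable f := fsummable (fun x => `|f x|).

Lemma abs_summable_mono f H : (forall x, `|f x| <= H x) -> fsummable H ->
  abs_summable f.
Proof. by move=> fH; exact: fsummable_mono. Qed.

Lemma rsum_eq_le f l : (forall e, 0 < e -> `|rsum f - l| <= e) -> rsum f = l.
Proof.
move=> h; apply/eqP; rewrite -subr_eq0 -normr_le0.
by apply/ler_addgt0Pl => e e0; rewrite addr0 h.
Qed.

Lemma rsum0 : rsum (fun _ : X => 0 : R) = 0.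
Proof.
apply: rsum_eq_le => e e0.
have s0 : fsummable (fun _ : X => 0 : R).
  by exists 0 => s _; rewrite big1.
have [s us /(_ (fun=> 0) s)] := rsum_approx (fun=> lexx 0) s0 e0.
rewrite big1 // => h; apply: h => // x; by rewrite normr0.
Qed.

Lemma rsumD f g : abs_summable f -> abs_summable g ->
  rsum (fun x => f x + g x) = rsum f + rsum g.
Proof.
move=> sf sg; apply: rsum_eq_le => e e0.
have H0 x : 0 <= `|f x| + `|g x| by rewrite addr_ge0.
have e3 : 0 < e / 3 by lra.
have [s us A] := rsum_approx H0 (fsummableD sf sg) e3.
have := A _ s (fun x => ler_normD (f x) (g x)) us (fun x => id).
have hf x : `|f x| <= `|f x| + `|g x| by rewrite lerDl.
have hg x : `|g x| <= `|f x| + `|g x| by rewrite lerDr.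
have := A _ s hf us (fun x => id).
have := A _ s hg us (fun x => id).
rewrite big_split /= !ler_norml.
by move=> /andP[? ?] /andP[? ?] /andP[? ?]; apply/andP; split; lra.
Qed.

Lemma rsumZ c f : abs_summable f -> rsum (fun x => c * f x) = c * rsum f.
Proof.
move=> sf; apply: rsum_eq_le => e e0.
have H0 x : 0 <= (1 + `|c|) * `|f x| by rewrite mulr_ge0 // addr_ge0.
have c1 : 0 < 1 + `|c| by rewrite ltr_pwDl.
have e3 : 0 < e / 2 / (1 + `|c|) by rewrite divr_gt0 //; lra.
have [s us A] := rsum_approx H0 (fsummableZ (ltW c1) sf) e3.
have hc x : `|c * f x| <= (1 + `|c|) * `|f x|.
  by rewrite normrM ler_wpM2r // lerDr.
have hf x : `|f x| <= (1 + `|c|) * `|f x|.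
  by rewrite -{1}[ `|f x| ]mul1r ler_wpM2r // lerDl.
have := A _ s hc us (fun x => id).
have := A _ s hf us (fun x => id).
rewrite -mulr_sumr => h1 h2.
have -> : rsum (fun x => c * f x) - c * rsum f =
  (rsum (fun x => c * f x) - c * \sum_(x <- s) f x)
  - c * (rsum f - \sum_(x <- s) f x) by ring.
apply: le_trans (ler_normB _ _) _; rewrite normrM.
set d := e / 2 / _ in h1 h2 e3.
have <- : (1 + `|c|) * d * 2 = e by rewrite /d; field; rewrite gt_eqF.
have : `|c| * `|rsum f - \sum_(x <- s) f x| <= `|c| * d by rewrite ler_wpM2l.
by have : 0 <= `|c| by []; nra.
Qed.

Lemma abs_summableD f g : abs_summable f -> abs_summable g ->
  abs_summable (fun x => f x + g x).
Proof.
move=> sf sg; apply: fsummable_mono (fsummableD sf sg) => x; exact: ler_normD.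
Qed.

Lemma abs_summableZ c f : abs_summable f -> abs_summable (fun x => c * f x).
Proof.
move=> sf; apply: fsummable_mono (fsummableZ (normr_ge0 c) sf) => x.
by rewrite normrM.
Qed.

Lemma rsum_sum (I : eqType) (r : seq I) (F : I -> X -> R) :
  (forall i, i \in r -> abs_summable (F i)) ->
  abs_summable (fun x => \sum_(i <- r) F i x) /\
  rsum (fun x => \sum_(i <- r) F i x) = \sum_(i <- r) rsum (F i).
Proof.
elim: r => [|i r IH] sF.
  have -> : (fun x => \sum_(i <- [::]) F i x) = fun=> 0.
    by apply/funext => x; rewrite big_nil.
  rewrite big_nil rsum0; split=> //; exists 0 => s _.
  by rewrite big1 // => ? _; rewrite normr0.
have [|s1 e1] := IH; first by move=> j jr; apply: sF; rewrite inE jr orbT.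
have -> : (fun x => \sum_(j <- i :: r) F j x) =
          fun x => F i x + \sum_(j <- r) F j x.
  by apply/funext => x; rewrite big_cons.
have si : abs_summable (F i) by apply: sF; rewrite mem_head.
by split; [exact: abs_summableD | rewrite rsumD // e1 big_cons].
Qed.

Lemma rsumN f : rsum (fun x => - f x) = - rsum f.
Proof.
rewrite /rsum (_ : EFin \o _ = (\- (EFin \o f))%E) // funeposN funenegN.
by rewrite opprB.
Qed.

Lemma rsum_exhaust f (S : nat -> seq X) : abs_summable f ->
  (forall n, uniq (S n)) -> (forall m n, (m <= n)%N -> {subset S m <= S n}) ->
  (forall x, f x != 0 -> exists n, x \in S n) ->
  (fun n => \sum_(x <- S n) f x) @ \oo --> rsum f.
Proof.
move=> sf uS mS cS; apply/cvgrPdist_le => e e0.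
have [s0 us0 A] := rsum_approx (fun x => normr_ge0 _) sf e0.
have [N hN] : exists N, forall x, x \in s0 -> f x != 0 -> x \in S N.
  elim: (s0) => [|x s [N hN]]; first by exists 0%N.
  have [M hM] : exists M, f x != 0 -> x \in S M.
    by have [_|/cS[M ?]] := eqVneq (f x) 0; [exists 0%N | exists M].
  exists (maxn M N) => y; rewrite inE => /predU1P[->{y} /hM|ys /(hN _ ys)].
    by apply: mS; rewrite leq_maxl.
  by apply: mS; rewrite leq_maxr.
exists N => // n /= Nn.
have -> : \sum_(x <- S n) f x = \sum_(x <- undup (S n ++ s0)) f x.
  rewrite (sum_cat_filter f (uS n) (undup_uniq (S n ++ s0))); last first.
    by move=> x xS; rewrite mem_undup mem_cat xS.
  rewrite [X in _ = _ + X]big_seq [X in _ = _ + X]big1 ?addr0 // => x.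
  rewrite mem_filter mem_undup mem_cat => /andP[/negbTE xS]; rewrite xS /= => xs.
  apply/eqP; apply: contraFT xS => /(hN _ xs); exact: mS.
apply: A => // [|x xs]; first exact: undup_uniq.
by rewrite mem_undup mem_cat xs orbT.
Qed.

Lemma cvg_sum_seq (fn : nat -> X -> R) f s :
  (forall x, (fn ^~ x) @ \oo --> f x) ->
  (fun n => \sum_(x <- s) fn n x) @ \oo --> \sum_(x <- s) f x.
Proof.
move=> cf; elim: s => [|x s IH].
  rewrite big_nil (_ : (fun _ => _) = fun=> 0); first exact: cvg_cst.
  by apply/funext => n; rewrite big_nil.
rewrite big_cons (_ : (fun _ => _) = fun n => fn n x + \sum_(y <- s) fn n y).
  by apply: cvgD.
by apply/funext => n; rewrite big_cons.
Qed.

Lemma rsum_dominated f (fn : nat -> X -> R) H : fsummable H ->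
  (forall n x, `|fn n x| <= H x) -> (forall x, (fn ^~ x) @ \oo --> f x) ->
  (fun n => rsum (fn n)) @ \oo --> rsum f.
Proof.
move=> sH fH cf; have H0 x : 0 <= H x by apply: le_trans (fH 0%N x).
have fleH x : `|f x| <= H x.
  have c : (fun n => `|fn n x|) @ \oo --> `|f x| by apply: cvg_norm; exact: cf.
  rewrite -(cvg_lim _ c) //; apply: limr_le; last by near=> n; exact: fH.
  by apply/cvg_ex; eexists; exact: c.
apply/cvgrPdist_le => e e0; have e3 : 0 < e / 3 by lra.
have [s us A] := rsum_approx H0 sH e3.
have cs : (fun n => \sum_(x <- s) fn n x) @ \oo --> \sum_(x <- s) f x.
  exact: cvg_sum_seq.
move/cvgrPdist_le : cs => /(_ _ e3) cs; near=> n.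
have : `|\sum_(x <- s) f x - \sum_(x <- s) fn n x| <= e / 3 by near: n.
have := A f s fleH us (fun x => id); have := A (fn n) s (fH n) us (fun x => id).
rewrite !ler_norml.
by move=> /andP[? ?] /andP[? ?] /andP[? ?]; apply/andP; split; lra.
Unshelve. all: by end_near. Qed.

(** A finite set meets finitely many parts, so the bound is a finite geometric
    sum. *)
Lemma fsum_le_partition g (I : X -> nat) (B t : R) : (forall x, 0 <= g x) ->
  0 <= B -> 0 <= t < 1 ->
  (forall k, fsum_le (fun x => if I x == k then g x else 0) (B * t ^+ k)) ->
  fsum_le g (B / (1 - t)).
Proof.
move=> g0 B0 /andP[t0 t1] gB s us.
have [N hN] : exists N, forall x, x \in s -> (I x < N)%N.
  exists (\max_(x <- s) I x).+1 => x xs; rewrite ltnS; exact: leq_bigmax_seq.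
rewrite (_ : \sum_(x <- s) g x =
  \sum_(k < N) \sum_(x <- s) if I x == k then g x else 0); last first.
  rewrite exchange_big /= big_seq [RHS]big_seq; apply: eq_bigr => x xs.
  rewrite (bigD1 (Ordinal (hN x xs))) //= eqxx big1 ?addr0 // => k kI.
  by case: eqP => // Ik; case/eqP: kI; apply/val_inj.
apply: le_trans (_ : \sum_(k < N) B * t ^+ k <= _).
  by apply: ler_sum => k _; exact: gB.
rewrite -mulr_sumr ler_wpM2l //.
have E : (1 - t) * \sum_(k < N) t ^+ k = 1 - t ^+ N.
  by rewrite -[LHS]opprK -mulNr opprB -subrX1 opprB.
rewrite -[leRHS]mul1r ler_pdivlMr ?subr_gt0 // mulrC E.
by rewrite gerBl exprn_ge0.
Qed.

End Sums.

(** * Trees rooted at a boundary point *)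

(** What remains of a homogeneous tree once a boundary point and a horocycle
    are fixed: the parent map, which points towards the boundary point, its
    fibres, and the horocyclic index.  The index excludes periodic points of
    the parent map, and confluence expresses connectedness. *)
Record horotree (X : choiceType) (q : nat) := Horotree {
  horo_pred : X -> X;
  horo_index : X -> int;
  horo_succ : X -> seq X;
  horo_index_pred : forall x, horo_index (horo_pred x) = horo_index x - 1;
  horo_succ_uniq : forall x, uniq (horo_succ x);
  size_horo_succ : forall x, size (horo_succ x) = q;
  mem_horo_succ : forall x y, (y \in horo_succ x) = (horo_pred y == x);
  horo_confluent : forall x y, exists m n, iter m horo_pred x = iter n horo_pred y }.

Section TreeCombinatorics.
Variables (X : choiceType) (q : nat) (T : horotree X q).

Local Notation p := (horo_pred T).
Local Notation h := (horo_index T).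
Local Notation S := (horo_succ T).

Lemma horo_index_iter n x : h (iter n p x) = h x - n%:Z.
Proof. by elim: n => [|n IH] /=; rewrite ?subr0 // horo_index_pred IH; lia. Qed.

Lemma iter_horo_pred_inj m n x : iter m p x = iter n p x -> m = n.
Proof. by move=> /(congr1 h); rewrite !horo_index_iter; lia. Qed.

(** The depth of [x] below [z] can only be the difference of the indices, which
    makes membership in a sector decidable by one iteration of the parent map. *)
Definition level z x : nat := `|h x - h z|%N.

Definition in_sector z x := iter (level z x) p x == z.

Lemma level_iter n x : level (iter n p x) x = n.
Proof. by rewrite /level horo_index_iter; lia. Qed.

Lemma in_sectorP z x : reflect (exists n, iter n p x = z) (in_sector z x).
Proof.
apply: (iffP eqP) => [<-|[n <-]]; first by eexists.
by rewrite level_iter.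
Qed.

Lemma in_sector_iter n x : in_sector (iter n p x) x.
Proof. by apply/in_sectorP; exists n. Qed.

Lemma in_sector_pred z x : in_sector z x -> in_sector (p z) x.
Proof. by case/in_sectorP => n <-; apply/in_sectorP; exists n.+1. Qed.

Lemma in_sector_le m n v x : (m <= n)%N ->
  in_sector (iter m p v) x -> in_sector (iter n p v) x.
Proof.
move=> /subnK <-; elim: (n - m)%N => //= k IH /IH; exact: in_sector_pred.
Qed.

Lemma in_sector_child z x y : p y = x -> y != z ->
  in_sector z y = in_sector z x.
Proof.
move=> <- yz; apply/in_sectorP/in_sectorP => [[[|n]]|[n <-]].
- by move=> /eqP; rewrite /= (negbTE yz).
- by rewrite iterSr => <-; exists n.
- by exists n.+1; rewrite iterSr.
Qed.

Fixpoint levels z l : seq X :=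
  if l is l'.+1 then [seq y | z' <- S z, y <- levels z' l'] else [:: z].

Lemma mem_levels z l x : (x \in levels z l) = (iter l p x == z).
Proof.
elim: l z x => [|l IH] z x /=; first by rewrite inE.
apply/allpairsPdep/eqP => [[z' [y [zz' yl ->]]]|xz].
  by move: yl zz'; rewrite /= IH mem_horo_succ => /eqP -> /eqP.
by exists (iter l p x), x; rewrite /= mem_horo_succ IH xz !eqxx.
Qed.

Lemma levels_uniq z l : uniq (levels z l).
Proof.
elim: l z => //= l IH z; apply: allpairs_uniq_dep => //; first exact: horo_succ_uniq.
move=> _ _ /allpairsPdep[z1 [y1 [_ + ->]]] /allpairsPdep[z2 [y2 [_ + ->]]] /=.
rewrite !mem_levels => /eqP e1 /eqP e2 e; move: e1 e2; rewrite e => -> e2.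
by rewrite -e2.
Qed.

Lemma sum_levelsS (V : nmodType) (F : X -> V) z l :
  \sum_(x <- levels z l.+1) F x =
  \sum_(z' <- S z) \sum_(x <- levels z' l) F x.
Proof. by rewrite /= big_allpairs_dep. Qed.

Definition top_levels z n := [seq y | l <- iota 0 n, y <- levels z l].

Lemma mem_top_levels z n x :
  reflect (exists2 l, (l < n)%N & iter l p x = z) (x \in top_levels z n).
Proof.
apply: (iffP allpairsPdep) => [[l [y [+ + ->]]]|[l ln xz]].
  by rewrite mem_iota mem_levels => ? /eqP ?; exists l.
by exists l, x; rewrite mem_iota mem_levels xz ln eqxx.
Qed.

Lemma top_levels_uniq z n : uniq (top_levels z n).
Proof.
apply: allpairs_uniq_dep; first exact: iota_uniq.
  by move=> l _; exact: levels_uniq.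
move=> _ _ /allpairsPdep[l1 [y1 [_ + ->]]] /allpairsPdep[l2 [y2 [_ + ->]]] /=.
rewrite !mem_levels => /eqP e1 /eqP e2 e; move: e1 e2; rewrite e => <-.
by move=> /iter_horo_pred_inj ->.
Qed.

Lemma sum_top_levels (V : nmodType) (F : X -> V) z n :
  \sum_(x <- top_levels z n) F x = \sum_(l < n) \sum_(x <- levels z l) F x.
Proof.
rewrite /top_levels big_allpairs_dep /=.
rewrite -(big_mkord xpredT (fun l => \sum_(x <- levels z l) F x)).
by rewrite /index_iota subn0.
Qed.

Lemma ex_ancestor v x : exists j, in_sector (iter j p v) x.
Proof.
have [m [n e]] := horo_confluent T x v.
by exists n; apply/in_sectorP; exists m.
Qed.

(** Distance from [v] to the point where the rays of [v] and [x] merge. *)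
Definition branch v x := ex_minn (ex_ancestor v x).

Lemma branchP v x n : in_sector (iter n p v) x = (branch v x <= n)%N.
Proof.
rewrite /branch; case: ex_minnP => j js jmin; apply/idP/idP => [/jmin //|jn].
exact: in_sector_le js.
Qed.

End TreeCombinatorics.

(** * Geometric constants *)

Section Constants.
Variables (R : realType) (q : nat).
Hypothesis q2 : (2 <= q)%N.

Definition qinv_sum l : R := \sum_(0 <= i < l.+1) q%:R ^- i.
Definition qpow_sum l : R := \sum_(0 <= j < l.+1) q%:R ^+ j.

Lemma q_gt0 : 0 < q%:R :> R.
Proof. by rewrite ltr0n (leq_trans _ q2). Qed.

Lemma q_ge2 : 2 <= q%:R :> R.
Proof. by rewrite ler_nat. Qed.

Lemma qinv_sum0 : qinv_sum 0 = 1.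
Proof. by rewrite /qinv_sum big_nat1 expr0 invr1. Qed.

Lemma qinv_sumS l : qinv_sum l.+1 = 1 + q%:R^-1 * qinv_sum l.
Proof.
rewrite /qinv_sum big_nat_recl // expr0 invr1 mulr_sumr; congr (_ + _).
by apply: eq_bigr => i _; rewrite exprS invfM.
Qed.

Lemma qinv_sumSr l : q%:R * qinv_sum l.+1 = q%:R * qinv_sum l + q%:R ^- l.
Proof.
rewrite {1}/qinv_sum big_nat_recr //= mulrDr; congr (_ + _).
by rewrite exprS invfM mulrA divff ?mul1r // gt_eqF // q_gt0.
Qed.

(** The harmonic equation, at a vertex of depth [l.+1] in a sector, for the
    function whose value at depth [k] is [qinv_sum k]: one neighbour has depth
    [l], the other [q] have depth [l.+2]. *)
Lemma qinv_sum_harmonic l :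
  q.+1%:R * qinv_sum l.+1 = qinv_sum l + q%:R * qinv_sum l.+2.
Proof.
have e := qinv_sumSr l.+1; have e' := qinv_sumSr l.
have -> : q%:R * qinv_sum l.+2 = q%:R * qinv_sum l.+1 + (qinv_sum l.+1 - qinv_sum l).
  rewrite e; congr (_ + _).
  by rewrite {1}/qinv_sum big_nat_recr //= -/(qinv_sum l) addrAC subrr add0r.
by rewrite -natr1; ring.
Qed.

Lemma qinv_sum_ge1 l : 1 <= qinv_sum l.
Proof.
by rewrite /qinv_sum big_nat_recl // expr0 invr1 lerDl sumr_ge0.
Qed.

Lemma qinv_sum_le2 l : qinv_sum l <= 2.
Proof.
elim: l => [|l IH]; first by rewrite qinv_sum0; lra.
rewrite qinv_sumS; have : q%:R^-1 * qinv_sum l <= 1; last by lra.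
by rewrite mulrC ler_pdivrMr ?q_gt0 // mul1r (le_trans IH) // q_ge2.
Qed.

Lemma qpow_sum0 : qpow_sum 0 = 1.
Proof. by rewrite /qpow_sum big_nat1 expr0. Qed.

Lemma qpow_sumS l : qpow_sum l.+1 = qpow_sum l + q%:R ^+ l.+1.
Proof. by rewrite /qpow_sum big_nat_recr. Qed.

Lemma qpow_sum_ge1 l : 1 <= qpow_sum l.
Proof. by rewrite /qpow_sum big_nat_recl // expr0 lerDl sumr_ge0. Qed.

Lemma qpow_sum_le l : qpow_sum l <= 2 * q%:R ^+ l.
Proof.
suff : qpow_sum l + 1 <= 2 * q%:R ^+ l by lra.
elim: l => [|l IH]; first by rewrite qpow_sum0 expr0; lra.
rewrite qpow_sumS exprS; have : 0 <= q%:R ^+ l :> R by [].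
by have := q_ge2; nra.
Qed.

Variable r : R.
Hypotheses (r0 : 0 < r) (qr1 : q%:R * r < 1).

Lemma r_lt1 : r < 1.
Proof. by have := q_ge2; have := r0; have := qr1; nra. Qed.

(** [beta] is the constant $b_0$, for [r] equal to $q^{-\alpha}$.  The companion
    [gamma] collects the contribution of the value of a harmonic function at
    the parent of the generator of a sector, and cancels in the kernel. *)
Definition beta_term l := r ^+ l.+1 * qinv_sum l * qpow_sum l.
Definition gamma_term l := r ^+ l.+1 * qinv_sum l * q%:R ^+ l.
Definition beta := limn (series beta_term).
Definition gamma := limn (series gamma_term).

Lemma cvg_geo_bound (u : nat -> R) B t : 0 <= t < 1 ->
  (forall n, 0 <= u n <= B * t ^+ n) -> cvgn (series u).
Proof.
move=> /andP[t0 t1] uB.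
apply: (@series_le_cvg _ u (geometric B t)); last first.
- by apply: is_cvg_geometric_series; rewrite ger0_norm.
- by move=> n; case/andP: (uB n).
- by move=> n; have /andP[] := uB n; exact: le_trans.
- by move=> n; case/andP: (uB n).
Qed.

Lemma qr_ge0 : 0 <= q%:R * r < 1.
Proof. by rewrite qr1 mulr_ge0 // ltW. Qed.

Lemma cvg_beta : series beta_term @ \oo --> beta.
Proof.
apply: (@cvg_geo_bound _ 4 _ qr_ge0) => l; rewrite /beta_term.
have := qinv_sum_ge1 l; have := qinv_sum_le2 l.
have := qpow_sum_ge1 l; have := qpow_sum_le l.
have : 0 < r ^+ l by rewrite exprn_gt0.
have : r ^+ l.+1 <= r ^+ l.
  by rewrite exprS ler_piMl // ?ltW // ?exprn_gt0 // r_lt1.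
have : 0 < r ^+ l.+1 by rewrite exprn_gt0.
rewrite exprMn; move: (r ^+ l) (r ^+ l.+1) (qinv_sum l) (qpow_sum l) (q%:R ^+ l).
move=> a b c d e b0 ba a0 de d1 c2 c1.
apply/andP; split; first by rewrite !mulr_ge0 //; lra.
apply: le_trans (_ : a * 2 * (2 * e) <= _); last by lra.
by rewrite ler_pM // ?mulr_ge0 ?ler_pM //; lra.
Qed.

Lemma cvg_gamma : series gamma_term @ \oo --> gamma.
Proof.
apply: (@cvg_geo_bound _ 2 _ qr_ge0) => l; rewrite /gamma_term.
have := qinv_sum_ge1 l; have := qinv_sum_le2 l.
have : 0 <= q%:R ^+ l :> R by [].
have : 0 < r ^+ l by rewrite exprn_gt0.
have : r ^+ l.+1 <= r ^+ l.
  by rewrite exprS ler_piMl // ?ltW // ?exprn_gt0 // r_lt1.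
have : 0 < r ^+ l.+1 by rewrite exprn_gt0.
rewrite exprMn; move: (r ^+ l) (r ^+ l.+1) (qinv_sum l) (q%:R ^+ l).
move=> a b c e b0 ba a0 e0 c2 c1.
apply/andP; split; first by rewrite !mulr_ge0 //; lra.
apply: le_trans (_ : a * 2 * e <= _); last by lra.
by rewrite ler_wpM2r // ler_pM //; lra.
Qed.

Lemma beta_gt0 : 0 < beta.
Proof.
apply: (@lt_le_trans _ _ (series beta_term 1)).
  by rewrite /series /= big_nat1 /beta_term qinv_sum0 qpow_sum0 !mulr1 expr1.
apply: nondecreasing_cvgn_le; last by apply/cvg_ex; eexists; exact: cvg_beta.
apply: nondecreasing_series => n _ _; rewrite /beta_term.
have := qinv_sum_ge1 n; have := qpow_sum_ge1 n => ? ?.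
by rewrite !mulr_ge0 ?exprn_ge0 // ?ltW //; lra.
Qed.

Lemma sum_geo_tail j N :
  \sum_(n < N) (if (j <= n.+1)%N then r ^+ n.+1 else 0) <= r ^+ j / (1 - r).
Proof.
have r1 : 0 < 1 - r by rewrite subr_gt0 r_lt1.
rewrite ler_pdivlMr // mulrC.
(* The telescoped form, exact up to the terms before [j], is what induction
   preserves. *)
suff : (1 - r) * \sum_(n < N) (if (j <= n.+1)%N then r ^+ n.+1 else 0)
       <= r ^+ j - r ^+ maxn j N.+1.
  by move=> /le_trans; apply; rewrite gerBl exprn_ge0 // ltW.
elim: N => [|N IH].
  rewrite big_ord0 mulr0 subr_ge0 -[j in leRHS](maxn0 j).
  apply: ler_wiXn2l; rewrite ?(ltW r0) ?(ltW r_lt1) //.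
  by rewrite maxn0 leq_maxl.
rewrite big_ord_recr /= mulrDr.
have [jN|Nj] := leqP j N.+1.
  move: IH; rewrite (maxn_idPr jN) (maxn_idPr (leqW jN)) => IH.
  by rewrite [r ^+ N.+2]exprS; lra.
by move: IH; rewrite (maxn_idPl (ltnW Nj)) (maxn_idPl Nj) mulr0 addr0.
Qed.

End Constants.

(** * Harmonic functions on a rooted tree *)

Section Kernel.
Variables (R : realType) (X : choiceType) (q : nat) (T : horotree X q) (r : R).
Hypothesis q2 : (2 <= q)%N.
Hypotheses (r0 : 0 < r) (qr1 : q%:R * r < 1).

Local Notation p := (horo_pred T).
Local Notation h := (horo_index T).
Local Notation S := (horo_succ T).
Local Notation a := (qinv_sum R q).
Local Notation A := (qpow_sum R q).
Local Notation beta := (beta q r).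
Local Notation gamma := (gamma q r).

Definition weight x : R := r ^ h x.

Lemma weight_gt0 x : 0 < weight x.
Proof. exact: exprz_gt0. Qed.

Lemma weight_iter n x : weight x = r ^+ n * weight (iter n p x).
Proof.
rewrite /weight horo_index_iter -[r ^+ n]/(r ^ n%:Z) -expfzDr ?gt_eqF //.
by congr (_ ^ _); lia.
Qed.

Lemma weight_pr x : weight x = r * weight (p x).
Proof. exact: (weight_iter 1). Qed.

Definition rharmonic (F : X -> R) :=
  forall x, q.+1%:R * F x = F (p x) + \sum_(y <- S x) F y.

(** The increment of [F] along the edge above [x].  For harmonic [F] it is a
    flow: what enters a vertex from above is distributed among its children. *)
Definition slope (F : X -> R) x := F x - F (p x).

Lemma sum_horo_succ_const x (c : R) : \sum_(y <- S x) c = q%:R * c.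
Proof.
by rewrite big_const_seq count_predT size_horo_succ iter_addr_0 mulr_natl.
Qed.

Lemma sum_slope F x : rharmonic F -> \sum_(y <- S x) slope F y = slope F x.
Proof.
move=> hF; rewrite big_seq (eq_bigr (fun y => F y - F x)); last first.
  by move=> y; rewrite mem_horo_succ /slope => /eqP ->.
rewrite -big_seq sumrB sum_horo_succ_const /slope; have := hF x.
rewrite -natr1 mulrDl mul1r; lra.
Qed.

(** Because the flow is conserved from level to level, the sum of [F] over a
    level of a sector sees only two numbers: the value of [F] just above the
    sector and the flow entering it. *)
Lemma sum_levels F z l : rharmonic F ->
  \sum_(x <- levels T z l) F x = q%:R ^+ l * F (p z) + A l * slope F z.
Proof.
move=> hF; elim: l z => [|l IH] z.
  by rewrite big_seq1 expr0 qpow_sum0 /slope; ring.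
rewrite sum_levelsS big_seq.
rewrite (eq_bigr (fun z' => q%:R ^+ l * F z + A l * slope F z')); last first.
  by move=> z'; rewrite mem_horo_succ => /eqP e; rewrite IH e.
rewrite -big_seq big_split /= sum_horo_succ_const -mulr_sumr sum_slope //.
by rewrite qpow_sumS exprS /slope; ring.
Qed.

Lemma sum_levels_weight z l :
  \sum_(x <- levels T z l) weight x = weight z * (q%:R * r) ^+ l.
Proof.
elim: l z => [|l IH] z; first by rewrite big_seq1 expr0 mulr1.
rewrite sum_levelsS big_seq (eq_bigr (fun=> r * weight z * (q%:R * r) ^+ l)).
  by rewrite -big_seq sum_horo_succ_const exprS; ring.
by move=> z'; rewrite mem_horo_succ => /eqP <-; rewrite IH -weight_pr.
Qed.

Definition sector_mass z x := if in_sector T z x then weight x else 0.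

(** The level at depth [l] has [q ^ l] vertices, each of weight [r ^ l] times
    the weight of [z]; this is where [q * r < 1], that is $\alpha > 1$, is used. *)
Lemma sector_mass_le z : fsum_le (sector_mass z) (weight z / (1 - q%:R * r)).
Proof.
have m0 x : 0 <= sector_mass z x.
  by rewrite /sector_mass; case: ifP => // _; rewrite ltW // weight_gt0.
apply: (@fsum_le_partition _ _ _ (level T z)) => //.
- by rewrite ltW // weight_gt0.
- exact: qr_ge0.
move=> k s us; rewrite -sum_levels_weight.
rewrite [leRHS]big_seq.
rewrite [leRHS](eq_bigr (fun x => if level T z x == k then sector_mass z x else 0)).
  rewrite -big_seq; apply: ler_sum_supp => //; first exact: levels_uniq.
  - move=> x; rewrite mem_levels /sector_mass /in_sector.
    by case: (level T z x =P k) => // ->; case: ifP.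
  - by move=> x; case: ifP.
move=> x; rewrite mem_levels => /eqP <-.
by rewrite level_iter eqxx /sector_mass in_sector_iter.
Qed.

(** * Functions carried by one sector *)

(** The potential of a unit flow entering the sector of [z] from above and
    splitting evenly ever after.  It is harmonic except at the parent of [z],
    where the flow has its source. *)
Definition green z x := if in_sector T z x then a (level T z x) else 0.

Lemma green_iter z x n : iter n p x = z -> green z x = a n.
Proof. by move=> <-; rewrite /green in_sector_iter level_iter. Qed.

Lemma green_ge0 z x : 0 <= green z x.
Proof.
rewrite /green; case: ifP => // _; exact: le_trans (qinv_sum_ge1 _ _ _).
Qed.

Lemma green_le z x : green z x <= if in_sector T z x then 2 else 0.
Proof. by rewrite /green; case: ifP => // _; exact: qinv_sum_le2. Qed.

Lemma green_laplacian z x :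
  green z (p x) + \sum_(y <- S x) green z y =
  q.+1%:R * green z x + (p z == x)%:R.
Proof.
have [zx|zx] := boolP (in_sector T z x); last first.
  have -> : green z x = 0 by rewrite /green (negbTE zx).
  have -> : green z (p x) = 0.
    rewrite /green; case: ifP => // /in_sectorP[n e]; case/in_sectorP: zx.
    by exists n.+1; rewrite iterSr.
  have other y : y \in S x -> y != z -> green z y = 0.
    rewrite mem_horo_succ => /eqP yx yz.
    by rewrite /green (in_sector_child yx yz) (negbTE zx).
  rewrite mulr0 !add0r; case: (p z =P x) => [zpx|zpx].
    have zS : z \in S x by rewrite mem_horo_succ zpx.
    rewrite (bigD1_seq z) ?horo_succ_uniq //= big_seq_cond big1 ?addr0.
      by rewrite (green_iter (erefl : iter 0 p z = z)) qinv_sum0.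
    by move=> y /andP[]; exact: other.
  rewrite big_seq big1 // => y yx; apply: other => //.
  by apply/eqP => e; apply: zpx; apply/eqP; rewrite -(mem_horo_succ T) -e.
have [n xz] := in_sectorP _ _ _ zx.
have -> : (p z == x) = false.
  apply/negP => /eqP e; have := @iter_horo_pred_inj _ _ T n.+1 0 (z).
  by rewrite iterSr e xz => /(_ erefl).
rewrite addr0 (green_iter xz) big_seq (eq_bigr (fun=> a n.+1)); last first.
  move=> y; rewrite mem_horo_succ => /eqP yx.
  by rewrite (@green_iter _ _ n.+1) // iterSr yx.
rewrite -big_seq sum_horo_succ_const; case: n xz => [|n] xz.
  have -> : green z (p x) = 0.
    rewrite /green; case: ifP => // /in_sectorP[n e].
    by have := @iter_horo_pred_inj _ _ T n.+1 0 x; rewrite iterSr e xz => /(_ erefl).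
  by rewrite add0r qinv_sumSr // qinv_sum0 expr0 invr1 -natr1 !mulr1.
by rewrite (@green_iter _ _ n) -?iterSr // qinv_sum_harmonic.
Qed.

Section Pairing.
Variable F : X -> R.
Hypotheses (hF : rharmonic F) (F2 : fsummable (fun x => F x ^+ 2 * weight x)).

(** A single majorant serves all the [g] below [G], as dominated convergence
    requires; it comes from [u * w <= u ^ 2 + w ^ 2]. *)
Lemma abs_summable_pairing (G : X -> R) :
  fsummable (fun x => G x ^+ 2 * weight x) ->
  fsummable (fun x => F x ^+ 2 * weight x + G x ^+ 2 * weight x) /\
  forall g, (forall x, `|g x| <= `|G x|) ->
    forall x, `|F x * g x * weight x| <= F x ^+ 2 * weight x + G x ^+ 2 * weight x.
Proof.
move=> G2; split; first exact: fsummableD.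
move=> g gG x; rewrite -mulrDl 2!normrM (gtr0_norm (weight_gt0 x)).
rewrite ler_wpM2r ?(ltW (weight_gt0 _)) // -(real_normK (num_real (F x))).
rewrite -(real_normK (num_real (G x))).
have := gG x; have : 0 <= `|g x| by [].
move: (`|F x|) (`|g x|) (`|G x|) => u t w t0 tw.
have : t ^+ 2 <= w ^+ 2 by rewrite lerXn2r // ?nnegrE // (le_trans t0).
by have := sqr_ge0 (u - t); rewrite sqrrB; have := sqr_ge0 u;
  have := sqr_ge0 t; lra.
Qed.

Lemma fsummable_green z : fsummable (fun x => green z x ^+ 2 * weight x).
Proof.
apply: (@fsummable_mono _ _ _ (fun x => 4 * sector_mass z x)); last first.
  by apply: fsummableZ => //; eexists; exact: sector_mass_le.
move=> x; have := green_le z x; have := green_ge0 z x; have := weight_gt0 x.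
rewrite /sector_mass; case: ifP => _ s0 b0 b2.
  by rewrite ler_wpM2r ?(ltW s0) //; nra.
have -> : green z x = 0 by lra.
by rewrite expr0n /= mul0r mulr0.
Qed.

Lemma abs_summable_green z : abs_summable (fun x => F x * green z x * weight x).
Proof.
have [s H] := abs_summable_pairing (fsummable_green z).
by apply: abs_summable_mono s; exact: H.
Qed.

(** By [sum_levels], the pairing with [green z] is an explicit combination of
    the value of [F] above [z] and of its flow into [z]. *)
Lemma pairing_green z : rsum (fun x => F x * green z x * weight x) =
  weight (p z) * (gamma * F (p z) + beta * slope F z).
Proof.
have c1 :
    (fun n => \sum_(x <- top_levels T z n) F x * green z x * weight x) @ \oo -->
    rsum (fun x => F x * green z x * weight x).
  apply: (rsum_exhaust (abs_summable_green z) (top_levels_uniq T z)).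
    move=> m n mn x /mem_top_levels[l lm xz].
    by apply/mem_top_levels; exists l => //; exact: leq_trans mn.
  move=> x; have [|zx] := boolP (in_sector T z x); last first.
    by rewrite /green (negbTE zx) mulr0 mul0r eqxx.
  by case/in_sectorP => n xz _; exists n.+1; apply/mem_top_levels; exists n.
rewrite -(cvg_lim (@Rhausdorff R) c1); apply: cvg_lim => //.
rewrite (_ : (fun n => _) = fun n =>
  weight (p z) * (series (gamma_term q r) n * F (p z)
               + series (beta_term q r) n * slope F z)); last first.
  apply/funext => n; rewrite sum_top_levels /series /= !big_mkord.
  rewrite !mulr_suml -big_split /= mulr_sumr; apply: eq_bigr => l _.
  rewrite big_seq (eq_bigr (fun x => a l * r ^+ l * weight z * F x)); last first.
    move=> x; rewrite mem_levels => /eqP xz.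
    by rewrite (green_iter xz) (weight_iter l x) xz; ring.
  rewrite -big_seq -mulr_sumr sum_levels // /gamma_term /beta_term exprS.
  by rewrite (weight_pr z); ring.
apply: cvgM; first exact: cvg_cst.
by apply: cvgD; apply: cvgM; (try exact: cvg_cst);
  [exact: cvg_gamma | exact: cvg_beta].
Qed.

End Pairing.

(** * The kernel of a rooted tree *)

Variable v : X.
Local Notation z n := (iter n p v).

Definition coef n : R := a n / (weight (z n.+1) * beta).

(** The kernel of the harmonic functions whose flow vanishes outside the sector
    of [z n.+1], has total [0] at [z n.+1] and splits evenly below its children,
    evaluated at [v].  Subtracting the average over the siblings of [z n]
    cancels the defects of the potentials. *)
Definition layer n x :=
  coef n * (green (z n) x - q%:R^-1 * \sum_(z' <- S (z n.+1)) green z' x).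

Definition kern_part n x := \sum_(k < n) layer k x.

Definition kern x := limn (kern_part ^~ x).

Lemma beta0 : 0 < beta. Proof. exact: beta_gt0. Qed.

Lemma coefE n : coef n = a n * r ^+ n.+1 / (weight v * beta).
Proof.
rewrite (weight_iter n.+1 v) /coef; field.
by rewrite !gt_eqF // ?weight_gt0 ?beta0 // exprn_gt0.
Qed.

Lemma layer_harmonic n : rharmonic (layer n).
Proof.
move=> x; rewrite /layer -mulr_sumr -mulrDr mulrCA; congr (_ * _).
rewrite sumrB -mulr_sumr exchange_big /= addrACA -opprD -mulrDr -big_split /=.
rewrite green_laplacian (eq_bigr _ (fun z' _ => green_laplacian z' x)).
rewrite big_split /= -mulr_sumr [X in _ - _ * (_ + X)](_ : _ =
    q%:R * (z n.+1 == x)%:R).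
  by field; rewrite gt_eqF // q_gt0.
rewrite -(sum_horo_succ_const (z n.+1)) big_seq [RHS]big_seq; apply: eq_bigr => z'.
by rewrite mem_horo_succ => /eqP ->.
Qed.

Definition kern_bound : R := 4 / (weight v * beta).

Lemma kern_bound_ge0 : 0 <= kern_bound.
Proof. by rewrite divr_ge0 // mulr_ge0 // ltW ?weight_gt0 ?beta0. Qed.

(** The coefficients decay like [r ^ n], and the function lives on the sector of
    [z n.+1], which [x] enters only for [n.+1] at least [branch T v x]. *)
Lemma layer_le n x :
  `|layer n x| <= kern_bound * (if (branch T v x <= n.+1)%N then r ^+ n.+1 else 0).
Proof.
have avg0 : 0 <= q%:R^-1 * \sum_(z' <- S (z n.+1)) green z' x.
  by rewrite mulr_ge0 ?invr_ge0 // sumr_ge0 // => *; exact: green_ge0.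
have avg2 : q%:R^-1 * \sum_(z' <- S (z n.+1)) green z' x <=
    if in_sector T (z n.+1) x then 2 else 0.
  rewrite mulrC ler_pdivrMr ?q_gt0 // mulrC -(sum_horo_succ_const (z n.+1)).
  rewrite big_seq [leRHS]big_seq; apply: ler_sum => z'; rewrite mem_horo_succ.
  move=> /eqP <-; apply: le_trans (green_le _ _) _.
  by case: ifP => [/in_sector_pred ->|] //; case: ifP.
have b2 : green (z n) x <= if in_sector T (z n.+1) x then 2 else 0.
  apply: le_trans (green_le _ _) _.
  by case: ifP => [/in_sector_pred /= ->|] //; case: ifP.
have b0 := green_ge0 (z n) x.
rewrite /layer normrM coefE -branchP.
set avg := q%:R^-1 * _ in avg0 avg2 *.
have d2 : `|green (z n) x - avg| <= if in_sector T (z n.+1) x then 2 else 0.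
  by rewrite ler_norml; move: b2 avg2; case: ifP => _ *; apply/andP; split; lra.
have c0 : 0 < weight v * beta by rewrite mulr_gt0 ?weight_gt0 ?beta0.
rewrite normrM normfV (gtr0_norm c0) /kern_bound.
have an : 0 <= a n * r ^+ n.+1.
  by rewrite mulr_ge0 ?exprn_ge0 ?(ltW r0) // (le_trans _ (qinv_sum_ge1 _ _ _)).
rewrite (ger0_norm an) mulrAC [leRHS]mulrAC ler_wpM2r ?invr_ge0 ?(ltW c0) //.
apply: le_trans (_ : 2 * r ^+ n.+1 * (if in_sector T (z n.+1) x then 2 else 0) <= _).
  apply: ler_pM => //; rewrite ler_wpM2r ?exprn_ge0 ?(ltW r0) //.
  exact: qinv_sum_le2.
by case: ifP => _; lra.
Qed.

(** A common majorant of all the partial sums, square summable because a level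
    set of [branch T v] lies in a sector. *)
Definition kern_majorant x := kern_bound / (1 - r) * r ^+ branch T v x.

Lemma kern_part_norm_le n x : \sum_(k < n) `|layer k x| <= kern_majorant x.
Proof.
apply: (le_trans (ler_sum _ _)) => [k _|]; first exact: layer_le.
rewrite -mulr_sumr /kern_majorant -mulrA ler_wpM2l ?kern_bound_ge0 // mulrC.
exact: (sum_geo_tail q2 r0 qr1).
Qed.

Lemma kern_part_le n x : `|kern_part n x| <= kern_majorant x.
Proof. by apply: le_trans (ler_norm_sum _ _ _) _; exact: kern_part_norm_le. Qed.

Lemma cvg_kern_part x : kern_part ^~ x @ \oo --> kern x.
Proof.
have E : kern_part ^~ x = series (layer ^~ x).
  by apply/funext => n; rewrite /kern_part /series /= big_mkord.
suff : cvgn (series (layer ^~ x)) by rewrite /kern E.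
apply: normed_cvg; apply: nondecreasing_is_cvgn.
  by apply: nondecreasing_series => n _ _; exact: normr_ge0.
exists (kern_majorant x) => _ [n _ <-].
by rewrite /= /series /= big_mkord; exact: kern_part_norm_le.
Qed.

Lemma kern_le x : `|kern x| <= kern_majorant x.
Proof.
have c : (fun n => `|kern_part n x|) @ \oo --> `|kern x|.
  by apply: cvg_norm; exact: cvg_kern_part.
rewrite -(cvg_lim (@Rhausdorff R) c); apply: limr_le.
  by apply/cvg_ex; eexists; exact: c.
by near=> n; exact: kern_part_le.
Unshelve. all: by end_near. Qed.

Lemma kern_harmonic : rharmonic kern.
Proof.
have hn n : rharmonic (kern_part n).
  move=> x; rewrite /kern_part mulr_sumr exchange_big -big_split /=.
  by apply: eq_bigr => k _; exact: layer_harmonic.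
move=> x; have c1 : (fun n => q.+1%:R * kern_part n x) @ \oo --> q.+1%:R * kern x.
  by apply: cvgM; [exact: cvg_cst | exact: cvg_kern_part].
rewrite -(cvg_lim (@Rhausdorff R) c1); apply: cvg_lim => //.
rewrite (_ : (fun n => _) =
    fun n => kern_part n (p x) + \sum_(y <- S x) kern_part n y).
  by apply: cvgD; [exact: cvg_kern_part | apply: cvg_sum_seq; exact: cvg_kern_part].
by apply/funext => n; exact: hn.
Qed.

Lemma fsummable_kern_majorant : fsummable (fun x => kern_majorant x ^+ 2 * weight x).
Proof.
apply: (@fsummable_mono _ _ _
  (fun x => (kern_bound / (1 - r)) ^+ 2 * ((r ^+ branch T v x) ^+ 2 * weight x))).
  by move=> x; rewrite /kern_majorant exprMn mulrA.
apply: fsummableZ; first exact: sqr_ge0.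
exists (weight v / (1 - q%:R * r) / (1 - r)).
have qr' : 0 < 1 - q%:R * r by rewrite subr_gt0.
(* On the vertices branching off at [k], the square of the majorant is
   of order [r ^ (2 k)], the mass of the sector of order [r ^ - k]. *)
apply: (@fsum_le_partition _ _ _ (branch T v)).
- by move=> x; rewrite mulr_ge0 ?sqr_ge0 // ltW // weight_gt0.
- by rewrite divr_ge0 // ltW // weight_gt0.
- by rewrite (ltW r0) (r_lt1 q2).
move=> k s us.
apply: (@le_trans _ _ (\sum_(x <- s) (r ^+ k) ^+ 2 * sector_mass (z k) x)).
  apply: ler_sum => x _; rewrite /sector_mass branchP.
  have s0 := weight_gt0 x.
  case: eqP => [->|_]; first by rewrite leqnn.
  by case: ifP => _; rewrite mulr_ge0 ?sqr_ge0 // ltW.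
rewrite -mulr_sumr; apply: le_trans (_ : (r ^+ k) ^+ 2 *
    (weight (z k) / (1 - q%:R * r)) <= _).
  by rewrite ler_wpM2l ?sqr_ge0 // sector_mass_le.
by rewrite (weight_iter k v) le_eqVlt; apply/orP; left; apply/eqP; ring.
Qed.

Section Reproduction.
Variable F : X -> R.
Hypotheses (hF : rharmonic F) (F2 : fsummable (fun x => F x ^+ 2 * weight x)).

Local Notation D := (slope F).

Lemma layer_pairingE n : (fun x => F x * layer n x * weight x) = fun x =>
  coef n * (F x * green (z n) x * weight x +
    - q%:R^-1 * \sum_(z' <- S (z n.+1)) F x * green z' x * weight x).
Proof.
by apply/funext => x; rewrite /layer -mulr_suml -mulr_sumr; ring.
Qed.

Lemma abs_summable_layer n : abs_summable (fun x => F x * layer n x * weight x).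
Proof.
rewrite layer_pairingE; apply: abs_summableZ; apply: abs_summableD.
  exact: abs_summable_green.
apply: abs_summableZ; apply: (rsum_sum _).1 => z' _.
exact: abs_summable_green.
Qed.

(** The terms in [gamma] cancel: all the children of [z n.+1] have the same
    parent.  Only flows are left, and [coef] removes the weight and [beta]. *)
Lemma pairing_layer n : rsum (fun x => F x * layer n x * weight x) =
  a n * (D (z n) - q%:R^-1 * D (z n.+1)).
Proof.
rewrite layer_pairingE.
have sb z' : abs_summable (fun x => F x * green z' x * weight x).
  exact: abs_summable_green.
have [ss es] := rsum_sum (fun z' (_ : z' \in S (z n.+1)) => sb z').
rewrite rsumZ; last by apply: abs_summableD => //; exact: abs_summableZ.
rewrite rsumD //; last exact: abs_summableZ.
rewrite rsumZ // es pairing_green // big_seq.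
rewrite (eq_bigr (fun z' => weight (z n.+1) * (gamma * F (z n.+1) + beta * D z'))).
  rewrite -big_seq -mulr_sumr big_split /= sum_horo_succ_const -mulr_sumr.
  rewrite sum_slope // /coef; field.
  by rewrite !gt_eqF // ?weight_gt0 ?beta0 ?q_gt0.
by move=> z'; rewrite mem_horo_succ => /eqP e; rewrite pairing_green // e.
Qed.

(** Telescoping, thanks to the recurrence [qinv_sumS]: the partial sums
    reproduce [F v] up to terms that live on the ray of [v]. *)
Lemma pairing_kern_part n : rsum (fun x => F x * kern_part n x * weight x) =
  F v - F (z n) - (a n - 1) * D (z n).
Proof.
have -> : (fun x => F x * kern_part n x * weight x) =
    fun x => \sum_(k <- iota 0 n) F x * layer k x * weight x.
  by apply/funext => x; rewrite /kern_part -mulr_suml -mulr_sumr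
    -(big_mkord xpredT (fun k => layer k x)) /index_iota subn0.
have [_ ->] := rsum_sum (fun k (_ : k \in iota 0 n) => abs_summable_layer k).
rewrite (eq_bigr _ (fun k _ => pairing_layer k)).
have -> : iota 0 n = index_iota 0 n by rewrite /index_iota subn0.
elim: n => [|n IH]; first by rewrite big_geq //= qinv_sum0 !subrr mul0r subrr.
by rewrite big_nat_recr //= {}IH qinv_sumS /slope /=; ring.
Qed.

(** A single term of the square sum of [F] is bounded, while the weight grows
    geometrically towards the boundary point. *)
Lemma cvg_ancestors : (fun n => F (z n)) @ \oo --> 0.
Proof.
have [B FB] := F2; have r1 := r_lt1 q2 r0 qr1.
have B0 : 0 <= B by have := FB [::] isT; rewrite big_nil.
have Fz n : F (z n) ^+ 2 <= B / weight v * r ^+ n.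
  have := FB [:: z n] isT; rewrite big_seq1 => Fz.
  rewrite (weight_iter n v) invfM mulrCA mulrAC mulrA -[leRHS]mulrA mulrC.
  rewrite -mulrA mulVf ?mulr1 ?gt_eqF ?exprn_gt0 //.
  by rewrite ler_pdivlMr ?weight_gt0.
apply/cvgrPdist_le => e e0.
have c : (fun n => B / weight v * r ^+ n) @ \oo --> 0.
  by apply: cvg_geometric; rewrite gtr0_norm.
move/cvgrPdist_le : c => /(_ _ (exprn_gt0 2 e0)) c; near=> n.
have : `|0 - B / weight v * r ^+ n| <= e ^+ 2 by near: n.
rewrite !sub0r !normrN (ger0_norm (le_trans (sqr_ge0 _) (Fz n))) => Fe.
rewrite -(@ler_pXn2r _ 2) ?nnegrE ?(ltW e0) //.
by rewrite real_normK ?num_real // (le_trans (Fz n)).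
Unshelve. all: by end_near. Qed.

Lemma kern_reproduces : abs_summable (fun x => F x * kern x * weight x) /\
  rsum (fun x => F x * kern x * weight x) = F v.
Proof.
have [sH H] := abs_summable_pairing F2 fsummable_kern_majorant.
have k0 x : 0 <= kern_majorant x by rewrite (le_trans _ (kern_le x)).
have kabs g : (forall x, `|g x| <= kern_majorant x) ->
    forall x, `|F x * g x * weight x| <=
      F x ^+ 2 * weight x + kern_majorant x ^+ 2 * weight x.
  by move=> gk; apply: H => x; rewrite (ger0_norm (k0 x)).
split; first by apply: abs_summable_mono sH; exact: kabs kern_le.
have c1 : (fun n => rsum (fun x => F x * kern_part n x * weight x)) @ \oo -->
    rsum (fun x => F x * kern x * weight x).
  apply: (rsum_dominated sH) => [n|x]; first by apply: kabs; exact: kern_part_le.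
  by apply: cvgM; [apply: cvgM|]; [exact: cvg_cst|exact: cvg_kern_part|
    exact: cvg_cst].
rewrite -(cvg_lim (@Rhausdorff R) c1); apply: cvg_lim => //.
rewrite (_ : (fun n => _) =
    fun n => F v - F (z n) - (a n - 1) * D (z n)); last first.
  by apply/funext => n; exact: pairing_kern_part.
have cD : (fun n => D (z n)) @ \oo --> 0.
  rewrite -[X in _ --> X](subr0 0); apply: cvgB; first exact: cvg_ancestors.
  by have := cvg_ancestors; rewrite -cvg_shiftS.
have c2 : (fun n => (a n - 1) * D (z n)) @ \oo --> 0.
  apply/cvgrPdist_le => e e0; move/cvgrPdist_le : cD => /(_ _ e0) cD.
  near=> n; have : `|0 - D (z n)| <= e by near: n.
  rewrite !sub0r !normrN normrM => De; apply: le_trans De.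
  have := qinv_sum_ge1 R q n; have := qinv_sum_le2 R q2 n => ? ?.
  by rewrite ler_piMl // ger0_norm; lra.
rewrite -[X in _ --> X]subr0; apply: cvgB c2.
by rewrite -[X in _ --> X]subr0; apply: cvgB cvg_ancestors; exact: cvg_cst.
Unshelve. all: by end_near. Qed.

End Reproduction.

End Kernel.

(** * The tree seen from a boundary point *)

Section NonBacktracking.
Variables (X : choiceType) (adj : rel X).
Hypothesis adj_irr : irreflexive adj.
Hypothesis acyclic : forall c, ucycle adj c -> (size c <= 2)%N.

(** A closest repetition along the walk would close up a simple cycle, whose
    length is then at most two: length one contradicts irreflexivity, length
    two is a backtrack. *)
Lemma nonbacktracking_neq (w : nat -> X) n :
  (forall i, (i < n)%N -> adj (w i) (w i.+1)) ->
  (forall i, (i.+1 < n)%N -> w i <> w i.+2) ->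
  forall d i, (0 < d)%N -> (i + d <= n)%N -> w i <> w (i + d)%N.
Proof.
move=> wadj wnb; elim/ltn_ind => d IH i d0 dn e.
pose c := mkseq (fun k => w (i + k)%N) d.
have uc : uniq c.
  apply/mkseq_uniqP => k l; rewrite !inE => kd ld ekl.
  have [kl|lk|//] := ltngtP k l; exfalso.
    have := IH (l - k)%N _ (i + k)%N; rewrite -addnA subnKC ?(ltnW kl) //.
    by move=> /(_ _ _ _) h; apply: h => //; lia.
  have := IH (k - l)%N _ (i + l)%N; rewrite -addnA subnKC ?(ltnW lk) //.
  by move=> /(_ _ _ _) h; apply: h => //; lia.
have cc : cycle adj c.
  case: d d0 dn e @c uc {IH} => // d _ dn e c uc.
  rewrite /c /mkseq /= -cats1.
  have -> : [seq w (i + k)%N | k <- iota 1 d] ++ [:: w (i + 0)%N] =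
      mkseq (fun k => w (i + k.+1)%N) d.+1.
    rewrite addn0 e mkseqS -cats1; congr (_ ++ _).
    by rewrite /mkseq -[1%N]addn0 iotaDl -map_comp; apply: eq_map.
  apply/(pathP (w 0%N)) => k; rewrite size_mkseq => kd.
  rewrite nth_mkseq // addnS; case: k kd => [|k] kd /=.
    by rewrite addn0; apply: wadj; lia.
  by rewrite nth_mkseq 1?ltnW // addnS; apply: wadj; lia.
have := acyclic (_ : ucycle adj c); rewrite /ucycle cc uc size_mkseq.
move=> /(_ isT); case: d d0 dn e {IH c uc cc} => // -[|[|//]] _ dn e _.
  by have := wadj i; rewrite -addn1 -e adj_irr => /(_ dn).
by apply: (wnb i); [lia | rewrite -addn2].
Qed.

Lemma chain_inj c m n : chain adj c -> c m = c n -> m = n.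
Proof.
move=> cc; wlog mn : m n / (m <= n)%N.
  by move=> H e; have [/H->//|/ltnW/H->] := leqP m n.
move: mn; rewrite leq_eqVlt => /predU1P[//|mn] e; exfalso.
apply: (@nonbacktracking_neq c n _ _ (n - m) m) => //; try lia.
- by move=> i _; case: (cc i).
- by move=> i _; case: (cc i).
- by rewrite subnKC // ltnW.
Qed.

Hypothesis adj_sym : symmetric adj.

(** Running backwards along one chain and then forwards along the other never
    backtracks, so the two chains never meet again. *)
Lemma fork_neq c c' k l : chain adj c -> chain adj c' ->
  c 0%N = c' 0%N -> c 1%N <> c' 1%N -> (0 < k)%N -> (0 < l)%N -> c k <> c' l.
Proof.
move=> cc cc' e0 n1 k0 l0 e.
pose w m := if (m <= l)%N then c' (l - m)%N else c (m - l)%N.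
have wl m : (m <= l)%N -> w m = c' (l - m)%N by rewrite /w => ->.
have wr m : (l <= m)%N -> w m = c (m - l)%N.
  rewrite /w leq_eqVlt => /predU1P[<-|lm]; first by rewrite leqnn subnn.
  by rewrite leqNgt lm.
apply: (@nonbacktracking_neq w (l + k) _ _ (l + k) 0%N); rewrite ?add0n //; try lia.
- move=> i _; have [il|li] := ltnP i l.
    rewrite !wl // 1?ltnW // adj_sym.
    by rewrite (_ : l - i = (l - i.+1).+1)%N; [case: (cc' (l - i.+1)%N)|lia].
  by rewrite !wr ?subSn // 1?leqW //; case: (cc (i - l)%N).
- move=> i _; have [il|li] := ltnP i.+1 l.
    rewrite !wl //; [|lia..].
    rewrite (_ : l - i = (l - i.+2).+2)%N; last by lia.
    by move=> /esym; case: (cc' (l - i.+2)%N).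
  have [il|li'] := ltnP i l.
    rewrite wl ?wr //; [|lia..].
    rewrite (_ : l - i = 1)%N; last by lia.
    by rewrite (_ : i.+2 - l = 1)%N; [move/esym|lia].
  rewrite !wr //; [|lia..].
  by rewrite (_ : i.+2 - l = (i - l).+2)%N; [case: (cc (i - l)%N)|lia].
- by rewrite wl // subn0 wr ?leq_addr // addKn e.
Qed.

End NonBacktracking.

Section BoundaryPoint.
Variables (X : choiceType) (adj : rel X) (q : nat).
Variables (omega : set (nat -> X)) (H0 : set X).
Hypothesis tree : homogeneous_tree adj q.
Hypothesis omegaP : boundary_point adj omega.

Let adj_sym : symmetric adj. Proof. by case: tree. Qed.
Let adj_irr : irreflexive adj. Proof. by case: tree. Qed.
Let acyclic c : ucycle adj c -> (size c <= 2)%N.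
Proof. by case: tree => _ _ _ + _; exact. Qed.
Let connected x y : exists2 p, path adj x p & last x p = y.
Proof. by case: tree. Qed.

Lemma chain_equivP (c c' : nat -> X) : chain_equiv c c' <->
  exists a b, forall k, c (a + k)%N = c' (b + k)%N.
Proof.
split=> [[m [N _ HN]]|[a [b ab]]].
  pose M := (N + absz m)%N; exists M, (absz (M%:Z + m)) => k.
  by apply: (HN (M + k)%N); rewrite /= /M; lia.
exists (b%:Z - a%:Z); exists a => // i /= ai j ij.
rewrite -(subnKC ai) ab; congr c'; lia.
Qed.

Lemma omega_chain c : omega c -> chain adj c.
Proof. by case: omegaP => c0 _ -> []. Qed.

Lemma omega_merge c c' : omega c -> omega c' ->
  exists a b, forall k, c (a + k)%N = c' (b + k)%N.
Proof.
case: omegaP => c0 _ -> [_ /chain_equivP[a [b ab]]] [_ /chain_equivP[a' [b' ab']]].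
exists (b + a')%N, (b' + a)%N => k.
by rewrite -!addnA -ab -ab' !addnA (addnC a).
Qed.

Lemma omega_closed c c' : omega c -> chain adj c' ->
  (exists a b, forall k, c (a + k)%N = c' (b + k)%N) -> omega c'.
Proof.
case: omegaP => c0 _ -> [_ /chain_equivP[a [b ab]]] cc' [a' [b' ab']].
split=> //; apply/chain_equivP; exists (a + a')%N, (b' + b)%N => k.
by rewrite -!addnA ab addnCA ab' .
Qed.

Lemma omega_shift c n : omega c -> omega (fun i => c (n + i)%N).
Proof.
move=> oc; apply: (omega_closed oc) => [i|].
  by rewrite !addnS; exact: (omega_chain oc).
by exists n, 0%N.
Qed.

Definition cons_chain y (c : nat -> X) i := if i is i'.+1 then c i' else y.

Lemma omega_cons c y : omega c -> adj y (c 0%N) -> y <> c 1%N ->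
  omega (cons_chain y c).
Proof.
move=> oc yc yc1; apply: (omega_closed oc) => [[|i]|] //=.
  exact: (omega_chain oc).
by exists 0%N, 1%N.
Qed.

(** The vertices from which some chain of the class starts are closed under
    adjacency: to reach a neighbour, drop the first vertex of the chain if it
    leads there, and prepend the neighbour otherwise. *)
Lemma omega_from x : exists c, omega c /\ c 0%N = x.
Proof.
have [c oc] : exists c, omega c.
  case: omegaP => c cc ->; exists c; split=> //.
  by apply/chain_equivP; exists 0%N, 0%N.
have [s + <-] := connected (c 0%N) x.
elim: s c oc => [|y s IH] c oc /=; first by exists c.
move=> /andP[cy ys]; have [e|/eqP n1] := eqVneq y (c 1%N).
  by rewrite e in ys *; exact: (IH _ (omega_shift 1 oc)).
by rewrite adj_sym in cy; exact: (IH _ (omega_cons oc cy n1)).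
Qed.

(** Two equivalent chains with the same origin have a common tail, which
    [fork_neq] forbids as soon as they separate. *)
Lemma omega_unique c c' : omega c -> omega c' -> c 0%N = c' 0%N -> c = c'.
Proof.
move=> oc oc' e0; apply/funext => i; apply/eqP; apply/negPn/negP => ni.
have ex : exists i, c i != c' i by exists i.
case: (ex_minnP ex) => -[|k] nk kmin; first by rewrite e0 eqxx in nk.
have ek : c (k + 0)%N = c' (k + 0)%N.
  rewrite addn0; apply/eqP; apply/negPn/negP => /kmin; lia.
have [a [b ab]] := omega_merge (omega_shift k oc) (omega_shift k oc').
apply: (fork_neq adj_irr acyclic adj_sym (omega_chain (omega_shift k oc))
  (omega_chain (omega_shift k oc')) ek _ _ _ (ab 1%N)); rewrite ?addn1 //.
exact/eqP.
Qed.

Local Notation ray_chain := (ray_chain omega).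

Lemma ray_chainP x : omega (ray_chain x) /\ ray_chain x 0%N = x.
Proof. exact: (xgetPex _ (omega_from x)). Qed.

Lemma ray_chain_unique c : omega c -> ray_chain (c 0%N) = c.
Proof.
move=> oc; have [ox e] := ray_chainP (c 0%N); exact: omega_unique.
Qed.

Definition parent x := ray_chain x 1%N.

Local Notation P := parent.

Lemma ray_chainE x n : ray_chain x n = iter n P x.
Proof.
elim: n x => [|n IH] x; first exact: (ray_chainP x).2.
have [ox e] := ray_chainP x.
by rewrite iterSr -IH /parent (ray_chain_unique (omega_shift 1 ox)).
Qed.

Lemma rayE x : ray omega x = range (fun n => iter n P x).
Proof.
rewrite /ray (_ : ray_chain x = fun n => iter n P x) //.
by apply/funext => n; exact: ray_chainE.
Qed.

Lemma ray_chain_chain x : chain adj (ray_chain x).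
Proof. exact: omega_chain (ray_chainP x).1. Qed.

Lemma adj_parent x : adj x (P x).
Proof.
by have [] := ray_chain_chain x 0%N; rewrite (ray_chainP x).2.
Qed.

(** Every edge is directed by the boundary point: a neighbour of [x] that is
    not on the ray of [x] gives rise to a ray passing through [x]. *)
Lemma adj_cases x y : adj x y -> y = P x \/ P y = x.
Proof.
move=> xy; have [->|/eqP n1] := eqVneq y (P x); [by left|right].
have [ox e] := ray_chainP x.
have yx : adj y (ray_chain x 0%N) by rewrite e adj_sym.
by have := ray_chain_unique (omega_cons ox yx n1); rewrite /parent /= => ->.
Qed.

Lemma iter_parent_inj m n x : iter m P x = iter n P x -> m = n.
Proof.
rewrite -!ray_chainE; exact: (chain_inj adj_irr acyclic (ray_chain_chain x)).
Qed.

Lemma parent_confluent x y : exists m n, iter m P x = iter n P y.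
Proof.
have [a [b ab]] := omega_merge (ray_chainP x).1 (ray_chainP y).1.
by exists a, b; rewrite -!ray_chainE -[a]addn0 ab addn0.
Qed.

(** * Distances, meets and the horocyclic index *)

(** The Busemann function of [omega] normalised at [o]. *)
Definition busemann o x : int :=
  xget 0 [set k | exists m n, iter m P x = iter n P o /\ k = m%:Z - n%:Z].

Lemma busemannE o x m n : iter m P x = iter n P o -> busemann o x = m%:Z - n%:Z.
Proof.
move=> e; apply: xget_subset1; first by exists m, n.
move=> _ _ [m1 [n1 [e1 ->]]] [m2 [n2 [e2 ->]]].
suff /iter_parent_inj : iter (n2 + m1) P x = iter (n1 + m2) P x by lia.
by rewrite !iterD e1 e2 -!iterD addnC.
Qed.

Lemma busemann_iter o x n : busemann o (iter n P x) = busemann o x - n%:Z.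
Proof.
have [a [b e]] := parent_confluent x o.
rewrite (busemannE e) (@busemannE _ _ a (n + b)); first by lia.
by rewrite -iterD addnC !iterD e.
Qed.

Lemma busemann_parent o x : busemann o (P x) = busemann o x - 1.
Proof. exact: (busemann_iter o x 1). Qed.

Lemma busemann_self o : busemann o o = 0.
Proof. by rewrite (@busemannE _ _ 0 0). Qed.

(** The Busemann function changes by one along each edge, so no walk climbs [n]
    levels in fewer than [n] steps. *)
Lemma dist_iter x n : dist adj x (iter n P x) = n.
Proof.
have walk : walk_length adj x (iter n P x) n.
  exists (traject P (P x) n); rewrite size_traject; split=> //.
    elim: n x => //= n IH x; by rewrite adj_parent IH.
  by elim: n x => //= n IH x; rewrite IH -iterSr.
have low m : walk_length adj x (iter n P x) m -> (n <= m)%N.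
  case=> s [xs ls <-].
  suff slow z : path adj z s -> busemann x z - (size s)%:Z <= busemann x (last z s).
    by have := slow _ xs; rewrite ls busemann_iter; lia.
  elim: s z {xs ls} => [|y s IH] z /=; first by lia.
  move=> /andP[zy ys]; have := IH _ ys.
  by case: (adj_cases zy) => [->|<-]; rewrite busemann_parent; lia.
apply: xget_subset1 => // a b [wa la] [wb lb].
by apply/eqP; rewrite eqn_leq la ?lb.
Qed.

(** The meet is the first common vertex of the two rays; minimality is attained
    on both sides at once because the rays agree from there on. *)
Lemma meetP x y : exists i j,
  [/\ meet omega x y = iter i P x, meet omega x y = iter j P y &
      forall k l, iter k P x = iter l P y -> (i <= k)%N /\ (j <= l)%N].
Proof.
have ex : exists i, `[< exists j, iter i P x = iter j P y >].
  by have [m [n e]] := parent_confluent x y; exists m; apply/asboolP; exists n.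
case: (ex_minnP ex) => i /asboolP[j e] imin.
have min k l : iter k P x = iter l P y -> (i <= k)%N /\ (j <= l)%N.
  move=> e'; have ik : (i <= k)%N by apply: imin; apply/asboolP; exists l.
  split=> //; move: e'; rewrite -(subnK ik) iterD e -iterD => /iter_parent_inj.
  by lia.
exists i, j; suff -> : meet omega x y = iter i P x by split.
apply: xget_subset1.
  rewrite /= !rayE; apply/seteqP; split=> [_ [[k _ <-] [l _ /esym kl]]|_ [k _ <-]].
    have [ik _] := min _ _ kl; exists (k - i)%N => //.
    by rewrite /= -iterD subnK.
  rewrite /=; split; first by exists (k + i)%N; rewrite //= iterD.
  by exists (k + j)%N; rewrite //= iterD e.
move=> z z' /= -> rr.
have [m _ /= em] : ray omega z z' by rewrite rr rayE; exists 0%N.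
have [n _ /= en] : ray omega z' z by rewrite -rr rayE; exists 0%N.
move: em en; rewrite !ray_chainE => em; rewrite -em -iterD.
by move=> /(@iter_parent_inj _ 0) /eqP; rewrite addn_eq0 => /andP[_ /eqP ->].
Qed.

Variable o : X.
Hypothesis H0E : H0 = [set x | same_horocycle adj omega o x].

Local Notation b := (busemann o).

Lemma same_horocycleE x : same_horocycle adj omega o x <-> b x = 0.
Proof.
rewrite /same_horocycle; have [i [j [ei ej _]]] := meetP o x.
rewrite {1}ei {1}ej !dist_iter (@busemannE _ _ j i) -?ej //.
by split=> ?; lia.
Qed.

(** Both sides of the definition of a horocycle are Busemann increments to the
    meet; [o] itself serves as the witness on the horocycle of index [0]. *)
Lemma HkE k x : Hk adj omega H0 k x <-> b x = k.
Proof.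
have key y : (dist adj x (meet omega x y))%:Z =
    (dist adj y (meet omega x y))%:Z + b x - b y.
  have [i [j [ei ej _]]] := meetP x y.
  rewrite {1}ei {1}ej !dist_iter.
  have : iter i P x = iter j P y by rewrite -ei.
  by move=> /(congr1 b); rewrite !busemann_iter; lia.
split=> [[y]|<-].
  by rewrite H0E /= => /same_horocycleE; have := key y; lia.
exists o; first by rewrite H0E /=; apply/same_horocycleE; rewrite busemann_self.
by rewrite (key o) busemann_self subr0.
Qed.

Lemma hindexE x : hindex adj omega H0 x = b x.
Proof.
apply: xget_subset1; first exact/HkE.
by move=> k l /HkE <- /HkE <-.
Qed.

Lemma predecessorE x : predecessor adj omega H0 x = P x.
Proof.
have PH : Hk adj omega H0 (hindex adj omega H0 x - 1) (P x).
  by apply/HkE; rewrite hindexE busemann_parent.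
have uniqP y : adj x y /\ Hk adj omega H0 (hindex adj omega H0 x - 1) y -> y = P x.
  move=> [/adj_cases[//|e] /HkE]; rewrite hindexE -e busemann_parent; lia.
apply: xget_subset1; first by split=> //; exact: adj_parent.
by move=> y z /uniqP -> /uniqP ->.
Qed.

Lemma parent2_neq x : P (P x) <> x.
Proof. by move=> /(@iter_parent_inj 2 0). Qed.

Lemma adj_parent_rev x y : P y = x -> adj x y.
Proof. by move=> <-; rewrite adj_sym adj_parent. Qed.

Lemma successorsE x : successors adj omega H0 x = [set y | P y = x].
Proof.
apply/seteqP; split=> y /=; rewrite /successors /= predecessorE.
  by case=> /adj_cases[].
move=> e; split; first exact: adj_parent_rev.
by rewrite -e => /esym; exact: parent2_neq.
Qed.

Lemma sectorE x y : sector omega x y <-> exists n, iter n P y = x.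
Proof.
rewrite /sector /= !rayE; split=> [xy|[n <-] _ [k _ <-]].
  by have [|n _ e] := xy x; [exists 0%N | exists n].
by exists (k + n)%N; rewrite //= iterD.
Qed.

Definition neighbours x : seq X := fset_set [set y | adj x y].

Lemma neighbours_finite x : finite_set [set y | adj x y].
Proof. by case: tree => _ _ _ _ /(_ x) c; exists q.+1. Qed.

Lemma mem_neighbours x y : (y \in neighbours x) = adj x y.
Proof.
rewrite /neighbours in_fset_set; last exact: neighbours_finite.
by apply/idP/idP => [/set_mem|h] //; exact/mem_set.
Qed.

Definition children x := rem (P x) (neighbours x).

Lemma children_uniq x : uniq (children x).
Proof. by rewrite rem_uniq // fset_uniq. Qed.

Lemma mem_children x y : (y \in children x) = (P y == x).
Proof.
rewrite mem_rem_uniq ?fset_uniq // !inE mem_neighbours.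
apply/andP/eqP => [[/eqP yP /adj_cases[]//]|e].
split; last exact: adj_parent_rev.
by apply/eqP => yP; apply: (@parent2_neq y); rewrite e.
Qed.

Lemma size_children x : size (children x) = q.
Proof.
rewrite size_rem ?mem_neighbours ?adj_parent //.
have -> : size (neighbours x) = #|` fset_set [set y | adj x y]| by [].
by case: tree => _ _ _ _ /(_ x) /card_fset_set ->.
Qed.

Definition boundary_horotree : horotree X q :=
  Horotree (busemann_parent o) children_uniq size_children mem_children
    parent_confluent.

Lemma sum_adj (V : nmodType) (f : X -> V) x :
  \sum_(y \in [set y | adj x y]) f y = f (P x) + \sum_(y <- children x) f y.
Proof.
rewrite fsbig_finite /=; last exact: neighbours_finite.
by rewrite (big_rem (P x)) //= -/(neighbours x) mem_neighbours adj_parent.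
Qed.

End BoundaryPoint.

(** * The summands of the kernel in closed form *)

Section KernelTerm.
Variables (R : realType) (X : choiceType) (q : nat) (T : horotree X q) (r : R).
Local Notation p := (horo_pred T).

Lemma layer_eq0 v n x : (forall l, iter l.+1 p x <> iter n.+1 p v) ->
  layer T r v n x = 0.
Proof.
move=> sep; have b0 z : p z = iter n.+1 p v -> green R T z x = 0.
  move=> pz; rewrite /green; case: ifP => // /in_sectorP[l e].
  by case: (sep l); rewrite iterS e.
rewrite /layer b0 // big_seq big1 ?mulr0 ?subrr ?mulr0 // => z'.
by rewrite mem_horo_succ => /eqP; exact: b0.
Qed.

(** Among the siblings of [iter n p v], only the one above [x] contributes. *)
Lemma layer_below v n l x : iter l.+1 p x = iter n.+1 p v ->
  layer T r v n x = coef T r v n * qinv_sum R q l *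
    ((iter l p x == iter n p v)%:R - q%:R^-1).
Proof.
move=> e; have greenE z : p z = iter n.+1 p v ->
    green R T z x = qinv_sum R q l * (iter l p x == z)%:R.
  move=> pz; case: (iter l p x =P z) => [xz|xz].
    by rewrite (green_iter R xz) mulr1.
  rewrite mulr0 /green; case: ifP => // /in_sectorP[k xk]; case: xz.
  have : iter k.+1 p x = iter l.+1 p x by rewrite iterS xk pz e.
  by move=> /iter_horo_pred_inj [<-].
rewrite /layer greenE // big_seq.
rewrite (eq_bigr (fun z' => qinv_sum R q l * (iter l p x == z')%:R)).
  rewrite -big_seq -mulr_sumr (bigD1_seq (iter l p x)) ?horo_succ_uniq //=.
  2: by rewrite mem_horo_succ -iterS e.
  rewrite eqxx big1; first by rewrite addr0 mulr1; ring.
  by move=> z'; rewrite eq_sym => /negbTE ->.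
by move=> z'; rewrite mem_horo_succ => /eqP; exact: greenE.
Qed.

End KernelTerm.

(** * The Bergman kernel *)

Section Complex.
Variable R : rcfType.

Lemma Re_sum (I : Type) (s : seq I) (f : I -> R[i]) :
  complex.Re (\sum_(i <- s) f i) = \sum_(i <- s) complex.Re (f i).
Proof. by apply: big_morph => // -[a b] [c d]. Qed.

Lemma Im_sum (I : Type) (s : seq I) (f : I -> R[i]) :
  complex.Im (\sum_(i <- s) f i) = \sum_(i <- s) complex.Im (f i).
Proof. by apply: big_morph => // -[a b] [c d]. Qed.

Lemma Re_natM n (x : R[i]) : complex.Re (n%:R * x) = n%:R * complex.Re x.
Proof.
rewrite !mulr_natl; elim: n => [|n IH]; first by rewrite !mulr0n.
by rewrite !mulrS -IH; case: x {IH} => a b; case: (_ *+ n).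
Qed.

Lemma Im_natM n (x : R[i]) : complex.Im (n%:R * x) = n%:R * complex.Im x.
Proof.
rewrite !mulr_natl; elim: n => [|n IH]; first by rewrite !mulr0n.
by rewrite !mulrS -IH; case: x {IH} => a b; case: (_ *+ n).
Qed.

End Complex.

Section BergmanKernel.
Variables (R : realType) (X : choiceType) (adj : rel X) (q : nat).
Variables (omega : set (nat -> X)) (H0 : set X) (alpha : R) (o : X).
Hypothesis q2 : (2 <= q)%N.
Hypothesis tree : homogeneous_tree adj q.
Hypothesis omegaP : boundary_point adj omega.
Hypothesis H0E : H0 = [set x | same_horocycle adj omega o x].
Hypothesis alpha1 : 1 < alpha.

Local Notation T := (boundary_horotree tree omegaP o).
Local Notation P := (parent omega).
Local Notation b := (busemann omega o).
Local Notation sigma := (sigma adj q omega H0 alpha).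
Local Notation bergman := (bergman adj q omega H0 alpha).
Local Notation inner := (inner adj q omega H0 alpha).

Definition ratio : R := q%:R `^ (- alpha).
Local Notation r := ratio.

Lemma ratio_gt0 : 0 < r.
Proof. by rewrite powR_gt0 // q_gt0. Qed.

Lemma q_ratio_lt1 : q%:R * r < 1.
Proof.
have q0 := q_gt0 R q2; have qge2 := q_ge2 R q2.
have -> : q%:R * r = q%:R `^ (1 - alpha).
  by rewrite powRD ?powRr1 ?(ltW q0) //; apply/implyP => _; rewrite gt_eqF.
rewrite lt_neqAle powR_eq1; apply/andP; split.
  rewrite !negb_or -leNgt ltW // andTb.
  rewrite gt_eqF ?(lt_le_trans _ qge2) ?ltr1n //=.
  by rewrite subr_eq0 lt_eqF.
by rewrite -[leRHS](powRr0 q%:R) ler_powR ?subr_le0 ?(ltW alpha1) // ler1n ltnW.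
Qed.

Let r0 := ratio_gt0.
Let qr1 := q_ratio_lt1.

Lemma powR_ratio (n : int) : q%:R `^ (- alpha * n%:~R) = r ^ n.
Proof. by rewrite powRrM powR_intmul // ltW. Qed.

Lemma sigmaE x : sigma x = weight T r x.
Proof. by rewrite /sigma (hindexE tree omegaP H0E) powR_ratio. Qed.

Lemma bconstE n : bconst q alpha n = r ^ n * beta q r.
Proof.
rewrite /bconst powR_ratio [X in series X](_ : _ = beta_term q r) //.
by apply/funext => l; rewrite (powR_ratio l.+1).
Qed.

Lemma harmonicE (f : X -> R[i]) : Defs.harmonic adj q f <->
  forall x, q.+1%:R * f x = f (P x) + \sum_(y <- horo_succ T x) f y.
Proof.
have q0 : q.+1%:R != 0 :> R[i] by rewrite pnatr_eq0.
rewrite /Defs.harmonic; split=> hf x; have := hf x;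
  rewrite (sum_adj tree omegaP) => hx.
  by rewrite {1}hx mulrA divff // mul1r.
by rewrite -hx mulrA mulVf // mul1r.
Qed.

Lemma harmonic_Re (f : X -> R[i]) : Defs.harmonic adj q f ->
  rharmonic T (fun x => complex.Re (f x)).
Proof.
move=> /harmonicE hf x; have := congr1 (@complex.Re R) (hf x).
rewrite Re_natM => ->; rewrite -Re_sum.
by case: (f _) => ? ?; case: (\sum_(_ <- _) _).
Qed.

Lemma harmonic_Im (f : X -> R[i]) : Defs.harmonic adj q f ->
  rharmonic T (fun x => complex.Im (f x)).
Proof.
move=> /harmonicE hf x; have := congr1 (@complex.Im R) (hf x).
rewrite Im_natM => ->; rewrite -Im_sum.
by case: (f _) => ? ?; case: (\sum_(_ <- _) _).
Qed.

Lemma normc2 (z : R[i]) :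
  Normc.normc z ^+ 2 = complex.Re z ^+ 2 + complex.Im z ^+ 2.
Proof. by case: z => a c /=; rewrite sqr_sqrtr // addr_ge0 ?sqr_ge0. Qed.

Lemma norm_summableE (f : X -> R[i]) :
  (\esum_(x in [set: X]) (Normc.normc (f x) ^+ 2 * sigma x)%:E < +oo)%E <->
  fsummable (fun x => Normc.normc (f x) ^+ 2 * weight T r x).
Proof.
have -> : (fun x => (Normc.normc (f x) ^+ 2 * sigma x)%:E) =
          (fun x => (Normc.normc (f x) ^+ 2 * weight T r x)%:E).
  by apply/funext => x; rewrite sigmaE.
have g0 x : 0 <= Normc.normc (f x) ^+ 2 * weight T r x.
  by rewrite mulr_ge0 ?sqr_ge0 // ltW // weight_gt0.
split=> [fin|[B /(fsum_leP _ g0) fB]]; last by rewrite (le_lt_trans fB) // ltry.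
exists (fine (\esum_(x in [set: X]) (Normc.normc (f x) ^+ 2 * weight T r x)%:E)).
apply/fsum_leP => //; rewrite fineK // ge0_fin_numE //.
by apply: esum_ge0 => x _; rewrite lee_fin.
Qed.

Lemma bergman_real (f : X -> R[i]) : bergman f ->
  [/\ rharmonic T (fun x => complex.Re (f x)),
      rharmonic T (fun x => complex.Im (f x)),
      fsummable (fun x => complex.Re (f x) ^+ 2 * weight T r x) &
      fsummable (fun x => complex.Im (f x) ^+ 2 * weight T r x)].
Proof.
case=> hf /norm_summableE sf; split; [exact: harmonic_Re|exact: harmonic_Im| |];
  apply: fsummable_mono sf => x;
  rewrite normc2 ler_wpM2r ?(ltW (weight_gt0 _ _ _)) //.
  by rewrite lerDl sqr_ge0.
by rewrite lerDr sqr_ge0.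
Qed.

Local Notation kern v := (kern T r v).

(** Against a real function, the inner product separates real and imaginary
    parts, so that reproduction is a statement on real harmonic functions. *)
Lemma inner_real f (k : X -> R) :
  inner f (fun x => ((k x)%:C)%C) =
  Complex (rsum (fun x => complex.Re (f x) * k x * weight T r x))
          (rsum (fun x => complex.Im (f x) * k x * weight T r x)).
Proof.
rewrite /inner /csum; congr Complex; congr rsum; apply/funext => x;
  rewrite sigmaE; case: (f x) => c d /=; ring.
Qed.

Lemma kern_bergman v : bergman (fun x => ((kern v x)%:C)%C).
Proof.
split.
  apply/harmonicE => x; have := kern_harmonic T q2 r0 qr1 v x.
  move=> /(congr1 (real_complex R)).
  by rewrite rmorphM rmorphD /= rmorph_nat rmorph_sum.
apply/norm_summableE.
apply: fsummable_mono (fsummable_kern_majorant T q2 r0 qr1 v) => x.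
rewrite ler_wpM2r ?(ltW (weight_gt0 _ _ _)) // normc2 /= expr0n /= addr0.
rewrite -real_normK ?num_real // lerXn2r ?nnegrE //; last exact: kern_le.
by rewrite (le_trans _ (kern_le T q2 r0 qr1 v x)).
Qed.

Lemma kern_inner v f : bergman f -> f v = inner f (fun x => ((kern v x)%:C)%C).
Proof.
move=> /bergman_real[hR hI sR sI]; rewrite inner_real.
rewrite (kern_reproduces q2 r0 qr1 v hR sR).2.
by rewrite (kern_reproduces q2 r0 qr1 v hI sI).2; case: (f v).
Qed.

Lemma inner_conj f g : inner g f = ((inner f g)^*)%C.
Proof.
rewrite /inner /csum /= -rsumN; congr Complex; congr rsum; apply/funext => x;
  case: (f x) => a1 b1; case: (g x) => a2 b2 /=; ring.
Qed.

(** Each of the two reproducing properties, applied to the other element, turns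
    one side into the same inner product.  This gives both the uniqueness of the
    reproducing element and the symmetry of the kernel. *)
Lemma reproducing_conj (k k' : X -> R[i]) v x : bergman k -> bergman k' ->
  (forall f, bergman f -> f v = inner f k) ->
  (forall f, bergman f -> f x = inner f k') -> k x = ((k' v)^*)%C.
Proof. by move=> bk bk' kv kx; rewrite kx // kv // -inner_conj. Qed.

Lemma repro_kernelE v :
  repro_kernel adj q omega H0 alpha v = fun x => ((kern v x)%:C)%C.
Proof.
apply: xget_subset1.
  by split=> [|f bf]; [exact: kern_bergman | exact: kern_inner].
have repr k : bergman k /\ (forall f, bergman f -> f v = inner f k) ->
    k = fun x => (((kern x v)%:C)^*)%C.
  move=> [bk kv]; apply/funext => x.
  apply: reproducing_conj bk (kern_bergman x) kv _ => f; exact: kern_inner.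
by move=> k k' /repr -> /repr ->.
Qed.

Lemma kern_sym v x : kern v x = kern x v.
Proof.
have := reproducing_conj (kern_bergman v) (kern_bergman x)
  (fun f => @kern_inner v f) (fun f => @kern_inner x f).
by move=> /(congr1 (@complex.Re R)).
Qed.

(** * The series of the kernel *)

Lemma iter_predecessorE n x : iter n (predecessor adj omega H0) x = iter n P x.
Proof. by apply: eq_iter => y; exact: (predecessorE tree omegaP H0E). Qed.

(** Two children of one vertex lie in the sector of a common child only when
    they are equal: [Gamma] is a Kronecker symbol minus its average. *)
Lemma Gamma_nE v n y : P y = iter n.+1 P v ->
  Gamma_n R adj q omega H0 n v y = (y == iter n P v)%:R - q%:R^-1.
Proof.
move=> Py; rewrite /Gamma_n !iter_predecessorE /Gamma.
have below z : P z = iter n.+1 P v -> z \in dsector omega (iter n.+1 P v).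
  move=> pz; apply/mem_set; split; first by apply/(sectorE tree omegaP); exists 1%N.
  by rewrite -pz => e; apply: (parent2_neq tree omegaP (x := z)); rewrite -e -e.
rewrite below // below //= (successorsE tree omegaP H0E).
have only z t : P z = P t -> sector omega z t -> t = z.
  move=> zt /(sectorE tree omegaP)[k e].
  have : iter k.+1 P t = iter 1 P t by rewrite iterS e zt.
  by move=> /(iter_parent_inj tree omegaP) [k0]; rewrite -e k0.
have qn0 : q%:R != 0 :> R by rewrite gt_eqF // q_gt0.
case: asboolP => [[z [/= pz s1 s2]]|no].
  rewrite (only z y) ?Py ?pz // (only z (iter n P v)) ?pz // eqxx.
  by rewrite mulrBl divff // mul1r.
case: (y =P iter n P v) => [e|]; last by rewrite sub0r.
case: no; exists y; split=> //=; rewrite -?e; apply/(sectorE tree omegaP);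
  by exists 0%N.
Qed.

(** With [j] the distance from [v] to the meet, the term of rank [k] of the
    series is the layer of rank [k + j - 1].  The layers of smaller rank vanish
    at [x], and so does the one of rank [j - 1] when the meet is [x]; when the
    meet is [v] there is no layer of rank [- 1].  Hence the shift by one between
    the two partial sums. *)
Lemma kernel_seriesE v x : exists j, forall K,
  kernel_series adj q omega H0 alpha v x K.+1 = kern_part T r v (K + j) x.
Proof.
have [i [j [wx wv min]]] := meetP tree omegaP x v.
set w := meet omega x v in wx wv.
have hw : hindex adj omega H0 w = b x - i%:Z.
  by rewrite (hindexE tree omegaP H0E) wx (busemann_iter tree omegaP).
have hw' : hindex adj omega H0 w = b v - j%:Z.
  by rewrite (hindexE tree omegaP H0E) wv (busemann_iter tree omegaP).
have generic k n l : n.+1 = (k + j)%N -> l.+1 = (k + i)%N ->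
    kernel_term adj q omega H0 alpha v x (- hindex adj omega H0 w - 1 + k%:Z)
    = layer T r v n x.
  move=> nk lk.
  have e : iter l.+1 P x = iter n.+1 P v.
    by rewrite nk lk !iterD -wx -wv.
  rewrite /kernel_term -/w.
  have -> : (- hindex adj omega H0 w - 1 + k%:Z == - hindex adj omega H0 w - 1)
      && (w \in [:: x; v]) = false.
    apply/negP => /andP[/eqP k0]; rewrite !inE => /orP[] /eqP e0.
      have /(iter_parent_inj tree omegaP) : iter i P x = iter 0 P x by rewrite -wx.
      by lia.
    have /(iter_parent_inj tree omegaP) : iter j P v = iter 0 P v by rewrite -wv.
    by lia.
  rewrite !(hindexE tree omegaP H0E v) !(hindexE tree omegaP H0E x).
  have -> : - hindex adj omega H0 w - 1 + k%:Z + b v = n%:Z by lia.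
  have -> : - hindex adj omega H0 w - 1 + k%:Z + b x = l%:Z by lia.
  rewrite /absz iter_predecessorE Gamma_nE -?iterS //.
  rewrite (layer_below (T := T) r e) bconstE /coef.
  have -> : - (- hindex adj omega H0 w - 1 + k%:Z) - 1 = b (iter n.+1 P v).
    by rewrite (busemann_iter tree omegaP); lia.
  rewrite /qsum -/(qinv_sum R q n) -/(qinv_sum R q l) -/(weight T r (iter n.+1 P v)).
  by congr (_ * _); rewrite mulrAC mulrC mulrA.
have sep n : (n.+1 < j)%N -> layer T r v n x = 0.
  by move=> nj; apply: layer_eq0 => l /min[_]; rewrite leqNgt nj.
exists j; elim=> [|K IH].
  rewrite /kernel_series /series /= big_nat1 add0n.
  case: j wv hw' min generic sep => [|j] wv hw' min generic sep.
    rewrite /kern_part big_ord0 /kernel_term -/w addr0 eqxx /=.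
    by rewrite {1}wv !inE eqxx orbT.
  rewrite /kern_part big_ord_recr /= big1 ?add0r => [|k _]; last first.
    by apply: sep; rewrite ltnS.
  case: i wx hw min generic => [|i] wx hw min generic; last exact: generic.
  rewrite layer_eq0 => [|l e]; last first.
    have : iter l.+1 P x = iter 0 P x by rewrite e -wv wx.
    by move=> /(iter_parent_inj tree omegaP).
  by rewrite /kernel_term -/w addr0 eqxx /= {1}wx !inE eqxx.
rewrite /kernel_series seriesSr /= -/(kernel_series _ _ _ _ _ _ _) IH.
by rewrite /kern_part addSn big_ord_recr /= (generic _ (K + j)%N (K + i)%N).
Qed.

Lemma cvg_kernel_series v x :
  kernel_series adj q omega H0 alpha v x @ \oo --> kern v x.
Proof.
have [j E] := kernel_seriesE v x; rewrite -cvg_shiftS.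
rewrite (_ : (fun n => _) = fun K => kern_part T r v (K + j) x); last first.
  by apply/funext => K; rewrite /= E.
by rewrite (cvg_shiftn j (kern_part T r v ^~ x)); exact: cvg_kern_part.
Qed.

End BergmanKernel.

Theorem theorem20 (R : realType) (X : choiceType) (adj : rel X) (q : nat)
    (omega : set (nat -> X)) (H0 : set X) (alpha : R) :
  (2 <= q)%N ->
  homogeneous_tree adj q ->
  boundary_point adj omega ->
  is_horocycle adj omega H0 ->
  1 < alpha ->
  let K := repro_kernel adj q omega H0 alpha in
  [/\ forall v x : X,
        cvgn (kernel_series adj q omega H0 alpha v x) /\
        K v x = ((limn (kernel_series adj q omega H0 alpha v x))%:C)%C,
      forall v x : X, complex.Im (K v x) = 0
    & forall v x : X, K v x = K x v].
Proof.
move=> q2 tree omegaP [base H0E] alpha1 K.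
have cvgK := @cvg_kernel_series _ _ _ _ _ _ _ _ q2 tree omegaP H0E alpha1.
have KE v x := congr1 (@^~ x)
  (@repro_kernelE _ _ _ _ _ _ _ _ q2 tree omegaP H0E alpha1 v).
split=> v x.
- split; first by apply/cvg_ex; eexists; exact: cvgK.
  by rewrite (cvg_lim (@Rhausdorff R) (cvgK v x)); exact: KE.
- by rewrite /K KE.
- by rewrite /K !KE (@kern_sym _ _ _ _ _ _ _ _ q2 tree omegaP H0E alpha1).
Qed.
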